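(* Let $G$ be a discrete group and $1<p<\infty$. Let $WCB_p(G)=\{u\in B_p(G):\Gamma_u \text{ is a weakly compact operator on } A_p(G)\}$, where $\Gamma_u(v)=uv$ for $v\in A_p(G)$. Then: (i) $A_p(G)\subseteq WCB_p(G)$; (ii) if moreover $G$ is amenable, then $WCB_p(G)=A_p(G)$.
   Context: For $1<p<\infty$ and $\frac1p+\frac1q=1$, the Herz algebra $A_p(G)$ is the space of functions $u=\sum_{i=1}^\infty g_i*f_i^{\vee}$ with $f_i\in L^p(G)$, $g_i\in L^q(G)$, $\sum_i\|f_i\|_p\|g_i\|_q<\infty$, where $f^\vee(x)=f(x^{-1})$ and convolution is with respect to counting (Haar) measure; it is a commutative Banach algebra under pointwise multiplication with norm $\|u\|_{A_p}=\inf\sum_i\|f_i\|_p\|g_i\|_q$. $B_p(G)$ is the set of bounded functions $u$ on $G$ with $uv\in A_p(G)$ for all $v\in A_p(G)$, normed by $\|u\|=\sup\{\|uv\|_{A_p}:\|v\|_{A_p}\le 1\}$. *)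

(* Defs.v *)
From HB Require Import structures.
From mathcomp Require Import all_boot all_order all_algebra.
From mathcomp Require Import complex.
From mathcomp Require Import all_classical all_reals all_analysis.

Set Implicit Arguments.
Unset Strict Implicit.
Unset Printing Implicit Defensive.

Import Order.TTheory GRing.Theory Num.Theory.
Local Open Scope classical_set_scope.
Local Open Scope ring_scope.

(** A (discrete) group: an arbitrary (possibly infinite) carrier with a group
    law.  The carrier is a choiceType only so that finite partial sums and
    [esum] make sense (harmless classically). *)
Record dgroup := DGroup {
  gcar :> choiceType;
  gmul : gcar -> gcar -> gcar;
  ginv : gcar -> gcar;
  gone : gcar;
  gmulA : forall x y z, gmul x (gmul y z) = gmul (gmul x y) z;
  gmul1 : forall x, gmul gone x = x;
  gmulV : forall x, gmul (ginv x) x = gone }.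

Section Herz.
Variable R : realType.
Local Notation C := R[i].

Definition cabs (z : C) : R := Num.sqrt (complex.Re z ^+ 2 + complex.Im z ^+ 2).

Definition hassumC (T : choiceType) (h : T -> C) (s : C) : Prop :=
  forall e : R, 0 < e -> exists F0 : seq T, forall F : seq T,
    uniq F -> {subset F0 <= F} -> cabs (\sum_(x <- F) h x - s) < e.

(** the sum of a summable complex family (0 if not summable) *)
Definition tsumC (T : choiceType) (h : T -> C) : C := xget 0 [set s | hassumC h s].

Definition conj_exp (p : R) : R := p / (p - 1).

Variable G : dgroup.

Definition inLp (p : R) (f : G -> C) : Prop :=
  (\esum_(x in [set: G]) ((cabs (f x)) `^ p)%:E < +oo)%E.
Definition pnorm (p : R) (f : G -> C) : R :=
  (fine (\esum_(x in [set: G]) ((cabs (f x)) `^ p)%:E)) `^ (p^-1).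

Definition check (f : G -> C) : G -> C := fun x => f (ginv x).
Definition conv (a b : G -> C) : G -> C :=
  fun x => tsumC (fun y => a y * b (gmul (ginv y) x)).

Definition Ap_rep (p : R) (f g : nat -> G -> C) (u : G -> C) : Prop :=
  [/\ forall i, inLp p (f i) /\ inLp (conj_exp p) (g i),
      (\esum_(i in [set: nat]) (pnorm p (f i) * pnorm (conj_exp p) (g i))%:E < +oo)%E
    & forall x, hassumC (fun i => conv (g i) (check (f i)) x) (u x)].

Definition Ap (p : R) (u : G -> C) : Prop := exists f g, Ap_rep p f g u.
Definition Apnorm (p : R) (u : G -> C) : R :=
  inf [set r : R | exists f g, Ap_rep p f g u /\
         r = fine (\esum_(i in [set: nat]) (pnorm p (f i) * pnorm (conj_exp p) (g i))%:E)].

Definition pmul (u v : G -> C) : G -> C := fun x => u x * v x.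

Definition Bp (p : R) (u : G -> C) : Prop :=
  (exists M : R, forall x, cabs (u x) <= M) /\ forall v, Ap p v -> Ap p (pmul u v).

Definition bdd_functional (p : R) (phi : (G -> C) -> C) : Prop :=
  (forall (a : C) u v, Ap p u -> Ap p v ->
     phi (fun x => a * u x + v x) = a * phi u + phi v) /\
  exists M : R, forall u, Ap p u -> cabs (phi u) <= M * Apnorm p u.

Definition weak_nbhs (p : R) (a : G -> C) (N : set (G -> C)) : Prop :=
  exists (n : nat) (phi : 'I_n -> (G -> C) -> C) (e : R),
    [/\ 0 < e, forall k, bdd_functional p (phi k)
      & forall w, Ap p w -> (forall k, cabs (phi k w - phi k a) < e) -> N w].

Definition weak_closure (p : R) (S : set (G -> C)) : set (G -> C) :=
  [set a | Ap p a /\ forall N, weak_nbhs p a N -> exists w, S w /\ N w].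

Definition weakly_compact (p : R) (K : set (G -> C)) : Prop :=
  K `<=` Ap p /\
  forall F : set_system (G -> C), ProperFilter F -> F K ->
    exists a, K a /\ forall B N, F B -> weak_nbhs p a N ->
      exists w, [/\ Ap p w, B w & N w].

Definition rel_weakly_compact (p : R) (S : set (G -> C)) : Prop :=
  weakly_compact p (weak_closure p S).

Definition Gamma_weakly_compact (p : R) (u : G -> C) : Prop :=
  rel_weakly_compact p [set w | exists v, [/\ Ap p v, Apnorm p v <= 1 & w = pmul u v]].

Definition WCBp (p : R) (u : G -> C) : Prop := Bp p u /\ Gamma_weakly_compact p u.

End Herz.

Definition bounded_fun (R : realType) (G : dgroup) (f : G -> R) : Prop :=
  exists M : R, forall x, `|f x| <= M.

Definition amenable (R : realType) (G : dgroup) : Prop :=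
  exists m : (G -> R) -> R,
  [/\ forall (a : R) f g, bounded_fun f -> bounded_fun g ->
        m (fun x => a * f x + g x) = a * m f + m g,
      forall f, bounded_fun f -> (forall x, 0 <= f x) -> 0 <= m f,
      m (fun _ => 1) = 1
    & forall (y : G) f, bounded_fun f -> m (fun x => f (gmul (ginv y) x)) = m f].

(* Main.v *)
Require Import Defs.
From HB Require Import structures.
From mathcomp Require Import all_boot all_order all_algebra.
From mathcomp Require Import complex.
From mathcomp Require Import all_classical all_reals all_analysis.
From mathcomp Require Import ring lra.
Import Order.TTheory GRing.Theory Num.Theory.
Local Open Scope ring_scope.

Set Implicit Arguments.
Unset Strict Implicit.

(** Part (i). In the discrete case finitely supported functions are dense in [Ap], and an
element [u] multiplies the pointwise closure of the unit ball of [Ap] into [Ap] without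
increasing norms beyond that of [u]. That closure is compact for pointwise convergence, and
for [u] in [Ap] multiplication by [u] is continuous on it from pointwise to norm convergence,
by approximating [u] with finitely supported functions. The weak closure of the image of the
ball is therefore the image of the pointwise closure, hence (even norm) compact.

Part (ii). Day's separation argument turns an invariant mean into Reiter's condition: there
are almost invariant probability densities [mu]. The functions [mu^(1/q) * (mu^(1/p))^v] lie
in the unit ball of [Ap] and tend to [1] pointwise. If multiplication by [u] is weakly
compact, its values on them have a weak cluster point in [Ap], which can only be [u]. *)

(** A product of two convolutions is a sum over pairs [(y, y')]; the substitution [y' = y t] turns
    it into a sum over [t] of single convolutions, and Hölder's inequality in [t] controls their
    total cost. This is why [Ap] is closed under products. Such rearrangements replace the index set
    [nat] by products with [G], which may be uncountable. Representations are therefore indexed by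
    any type, with upper bounds in place of norms, and return to [nat] at the end: only countably
    many terms can have nonzero cost. Joining representations of infinitely many elements in this
    way also stands in for completeness of [Ap]. In part (i) the obstacle is that a pointwise limit
    of the unit ball may leave [Ap], so submultiplicativity does not apply to it. A finitely
    supported factor, however, sees only finitely many of its values and cannot distinguish it from
    an element of the ball, up to a small error. In part (ii) the separation argument yields almost
    invariance in [l1], while the convolution estimate needs it in [lp]; the passage is
    [|a^(1/p) - b^(1/p)|^p <= |a - b|]. *)

Section ComplexModulus.
Context {R : realType}.
Implicit Types x y z : R[i].
Local Open Scope complex_scope.

Lemma cabsE z : cabs z = Normc.normc z.
Proof. by case: z. Qed.

Lemma cabs_ge0 z : 0 <= cabs z.
Proof. exact: sqrtr_ge0. Qed.

Lemma cabs0 : cabs (0 : R[i]) = 0.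
Proof. by rewrite cabsE Normc.normc0. Qed.

Lemma cabs1 : cabs (1 : R[i]) = 1.
Proof. by rewrite cabsE Normc.normc1. Qed.

Lemma cabs_eq0 z : cabs z = 0 -> z = 0.
Proof. by rewrite cabsE => /Normc.eq0_normc. Qed.

Lemma cabsM x y : cabs (x * y) = cabs x * cabs y.
Proof. by rewrite !cabsE Normc.normcM. Qed.

Lemma cabsN z : cabs (- z) = cabs z.
Proof. by rewrite !cabsE normcN. Qed.

Lemma cabsD x y : cabs (x + y) <= cabs x + cabs y.
Proof. by rewrite !cabsE le_normcD. Qed.

Lemma cabs_distC x y : cabs (x - y) = cabs (y - x).
Proof. by rewrite -cabsN opprB. Qed.

Lemma cabs_distD z x y : cabs (x - y) <= cabs (x - z) + cabs (z - y).
Proof. by rewrite (_ : x - y = (x - z) + (z - y)) ?cabsD//; ring. Qed.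

Lemma cabs_sum (T : Type) (F : seq T) (h : T -> R[i]) :
  cabs (\sum_(t <- F) h t) <= \sum_(t <- F) cabs (h t).
Proof.
elim/big_rec2: _ => [|t u v _ uv]; first by rewrite cabs0.
by rewrite (le_trans (cabsD _ _))// lerD2l.
Qed.

Lemma cabs_real (a : R) : cabs a%:C = `|a|.
Proof. by rewrite /cabs /= expr0n /= addr0 sqrtr_sqr. Qed.

Lemma cabs_i : cabs ('i : R[i]) = 1.
Proof. by rewrite /cabs /= expr0n /= add0r expr1n sqrtr1. Qed.

Lemma ler_Re_cabs z : `|complex.Re z| <= cabs z.
Proof. by rewrite -sqrtr_sqr ler_wsqrtr// lerDl sqr_ge0. Qed.

Lemma ler_Im_cabs z : `|complex.Im z| <= cabs z.
Proof. by rewrite -sqrtr_sqr ler_wsqrtr// lerDr sqr_ge0. Qed.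

Lemma cabs_le_ReIm z : cabs z <= `|complex.Re z| + `|complex.Im z|.
Proof.
rewrite [z in X in X <= _]complexE (le_trans (cabsD _ _))// cabsM cabs_i mul1r.
by rewrite !cabs_real.
Qed.

Lemma cabs_small z : (forall e, 0 < e -> cabs z < e) -> z = 0.
Proof.
move=> H; apply: cabs_eq0; apply/eqP; rewrite eq_le cabs_ge0 andbT leNgt.
by apply/negP => /H; rewrite ltxx.
Qed.

End ComplexModulus.

(** * Nonnegative families, through bounds on finite partial sums *)

Section FiniteSums.
Context {R : realType}.
Implicit Types (T U : choiceType).

(** Real-valued substitute for a bound on [esum], which spares the finiteness side conditions of
    extended reals; [sums_le_esum] shows that both agree for nonnegative families. *)
Definition sums_le T (a : T -> R) (M : R) :=
  forall F : seq T, uniq F -> \sum_(t <- F) a t <= M.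

Lemma sums_le_ge0 T (a : T -> R) M : sums_le a M -> 0 <= M.
Proof. by move=> /(_ [::] isT); rewrite big_nil. Qed.

Lemma sums_leW T (a b : T -> R) M N : (forall t, a t <= b t) -> M <= N ->
  sums_le b M -> sums_le a N.
Proof.
by move=> ab MN bM F uF; rewrite (le_trans _ MN)// (le_trans _ (bM F uF))// ler_sum.
Qed.

Lemma sums_leD T (a b : T -> R) M N :
  sums_le a M -> sums_le b N -> sums_le (fun t => a t + b t) (M + N).
Proof. by move=> aM bN F uF; rewrite big_split lerD ?aM ?bN. Qed.

Lemma sums_leZ T (a : T -> R) M c : 0 <= c ->
  sums_le a M -> sums_le (fun t => c * a t) (c * M).
Proof. by move=> c0 aM F uF; rewrite -mulr_sumr ler_wpM2l ?aM. Qed.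

Lemma sums_le1 T (a : T -> R) M t : sums_le a M -> a t <= M.
Proof. by move=> /(_ [:: t] isT); rewrite big_seq1. Qed.

Lemma sum_subseq T (a : T -> R) (F G : seq T) : (forall t, 0 <= a t) ->
  uniq F -> uniq G -> {subset F <= G} -> \sum_(t <- F) a t <= \sum_(t <- G) a t.
Proof.
move=> a0 uF uG FG; rewrite [leRHS](bigID (mem F)) /= (_ : \sum_(t <- G | t \in F) a t = \sum_(t <- F) a t).
  by rewrite lerDl sumr_ge0.
rewrite -big_filter; apply: perm_big; apply: uniq_perm => //.
  exact: filter_uniq.
by move=> t; rewrite mem_filter andb_idr//; exact: FG.
Qed.

Lemma sums_le_esum T (a : T -> R) M : (forall t, 0 <= a t) ->
  sums_le a M <-> (\esum_(t in [set: T]) (a t)%:E <= M%:E)%E.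
Proof.
move=> a0; split=> [aM|eM F uF].
  apply: ge_ereal_sup => _ [X [finX _]] <-.
  rewrite fsbig_finite//= sumEFin lee_fin aM//.
rewrite -lee_fin -sumEFin (le_trans _ eM)//; apply: esum_ge.
exists [set` F]%classic; first by split.
by rewrite -fsbig_seq.
Qed.

Lemma esum_fin_sums_le T (a : T -> R) : (forall t, 0 <= a t) ->
  (\esum_(t in [set: T]) (a t)%:E < +oo)%E ->
  sums_le a (fine (\esum_(t in [set: T]) (a t)%:E)).
Proof.
move=> a0 fin; apply/sums_le_esum => //; rewrite fineK// ge0_fin_numE//.
by apply: esum_ge0 => t _; rewrite lee_fin.
Qed.

Lemma sums_le_fin T (a : T -> R) M : (forall t, 0 <= a t) -> sums_le a M ->
  (\esum_(t in [set: T]) (a t)%:E < +oo)%E /\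
  fine (\esum_(t in [set: T]) (a t)%:E) <= M.
Proof.
move=> a0 /sums_le_esum-/(_ a0) aM.
have fin : (\esum_(t in [set: T]) (a t)%:E < +oo)%E by rewrite (le_lt_trans aM) ?ltry.
split=> //; rewrite -lee_fin fineK// ge0_fin_numE//.
by apply: esum_ge0 => t _; rewrite lee_fin.
Qed.

Lemma sums_le_sup T (a : T -> R) M : (forall t, 0 <= a t) -> sums_le a M ->
  exists S, sums_le a S /\ forall e, 0 < e -> exists2 F, uniq F & S - e < \sum_(t <- F) a t.
Proof.
move=> a0 aM; pose A := [set r | exists2 F : seq T, uniq F & r = \sum_(t <- F) a t]%classic.
have supA : has_sup A.
  split; first by exists 0; exists [::] => //; rewrite big_nil.
  by exists M => _ [F uF ->]; exact: aM.
exists (sup A); split=> [F uF|e e0].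
  by apply: sup_upper_bound => //; exists F.
by have [_ [F uF ->] lt] := sup_adherent e0 supA; exists F.
Qed.

(** A finite sum within [e] of the supremum leaves at most [e] for the remaining terms. *)
Lemma sums_le_tail T (a : T -> R) M e : (forall t, 0 <= a t) -> sums_le a M -> 0 < e ->
  exists2 F0, uniq F0 & sums_le (fun t => if t \in F0 then 0 else a t) e.
Proof.
move=> a0 aM e0; have [S [aS near_S]] := sums_le_sup a0 aM.
have [F0 uF0 ltF0] := near_S _ e0; exists F0 => // F uF.
have : \sum_(t <- F0 ++ [seq t <- F | t \notin F0]) a t <= S.
  apply: aS; rewrite cat_uniq uF0 filter_uniq// andbT /=.
  by apply/hasPn => t; rewrite mem_filter => /andP[].
rewrite big_cat /= big_filter [X in _ + X]big_mkcond /=.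
under [X in _ + X]eq_bigr do rewrite if_neg.
by lra.
Qed.

Lemma sums_le_prod T U (a : T * U -> R) (b : T -> R) M : (forall z, 0 <= a z) ->
  (forall t, sums_le (fun u => a (t, u)) (b t)) -> sums_le b M -> sums_le a M.
Proof.
move=> a0 ab bM F uF; pose F1 := undup (map fst F); pose F2 := undup (map snd F).
(* A finite set of pairs is enlarged to the rectangle spanned by its projections. *)
apply: (@le_trans _ _ (\sum_(z <- [seq (t, u) | t <- F1, u <- F2]) a z)).
  apply: sum_subseq => //; first by apply: allpairs_uniq; rewrite ?undup_uniq// => -[? ?] [].
  move=> [t u] tuF; apply/allpairsP; exists (t, u); split=> //=; rewrite mem_undup; apply/mapP.
    by exists (t, u).
  by exists (t, u).
rewrite big_allpairs; apply: (le_trans _ (bM F1 (undup_uniq _))).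
by apply: ler_sum => t _; apply: ab; rewrite undup_uniq.
Qed.

Lemma sums_le_inj T U (a : T -> R) (e : U -> T) M : injective e ->
  sums_le a M -> sums_le (a \o e) M.
Proof.
by move=> einj aM F uF; rewrite -(big_map e xpredT a); apply: aM; rewrite map_inj_uniq.
Qed.

End FiniteSums.

Section Mass.
Context {R : realType}.
Implicit Types (T : choiceType).

Definition mass T (a : T -> R) : R := fine (\esum_(t in [set: T]) (a t)%:E).

Lemma sums_le_mass T (a : T -> R) M : (forall t, 0 <= a t) -> sums_le a M -> sums_le a (mass a).
Proof. by move=> a0 aM; apply: esum_fin_sums_le => //; case: (sums_le_fin a0 aM). Qed.

Lemma mass_le T (a : T -> R) M : (forall t, 0 <= a t) -> sums_le a M -> mass a <= M.
Proof. by move=> a0 aM; case: (sums_le_fin a0 aM). Qed.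

Lemma massD T (a b : T -> R) M N : (forall t, 0 <= a t) -> (forall t, 0 <= b t) ->
  sums_le a M -> sums_le b N -> mass (fun t => a t + b t) = mass a + mass b.
Proof.
move=> a0 b0 /(sums_le_fin a0)[fa _] /(sums_le_fin b0)[fb _].
have ge0 (c : T -> R) : (forall t, 0 <= c t) -> (0 <= \esum_(t in [set: T]) (c t)%:E)%E.
  by move=> c0; apply: esum_ge0 => t _; rewrite lee_fin.
rewrite /mass -fineD ?ge0_fin_numE ?ge0// -esumD => [|t _|t _]; rewrite ?lee_fin//.
Qed.

Lemma massZ T (a : T -> R) M c : (forall t, 0 <= a t) -> sums_le a M -> 0 < c ->
  mass (fun t => c * a t) = c * mass a.
Proof.
move=> a0 aM c0; have ca0 t : 0 <= c * a t by rewrite mulr_ge0// ltW.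
have caM := sums_leZ (ltW c0) aM; apply/eqP; rewrite eq_le; apply/andP; split.
  by apply: mass_le => //; apply: sums_leZ; [exact: ltW|exact: sums_le_mass aM].
rewrite mulrC -ler_pdivlMr// mulrC; apply: mass_le => //.
have ci : 0 <= c^-1 by rewrite invr_ge0 ltW.
apply: sums_leW (sums_leZ ci (sums_le_mass ca0 caM)) => // t.
by rewrite mulKf// gt_eqF.
Qed.

Lemma mass0 T : mass (fun _ : T => 0) = 0.
Proof. by rewrite /mass esum1. Qed.

End Mass.

(** * Unconditional sums of complex families *)

Section Unconditional.
Context {R : realType}.
Implicit Types (T U : choiceType).
Local Open Scope complex_scope.

(** Eventuality along the net of finite sets: [hassumC h s] unfolds to one such statement for each
    [e]. *)
Definition cofinally T (P : seq T -> Prop) :=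
  exists F0 : seq T, forall F, uniq F -> {subset F0 <= F} -> P F.

Lemma cofinallyI T (P Q : seq T -> Prop) :
  cofinally P -> cofinally Q -> cofinally (fun F => P F /\ Q F).
Proof.
move=> [F PF] [F' QF]; exists (F ++ F') => G uG sG; split.
  by apply: PF => // x xF; apply: sG; rewrite mem_cat xF.
by apply: QF => // x xF; apply: sG; rewrite mem_cat xF orbT.
Qed.

Lemma cofinally_ex T (P : seq T -> Prop) : cofinally P -> exists2 F, uniq F & P F.
Proof.
by move=> [F PF]; exists (undup F); rewrite ?undup_uniq//; apply: PF;
  rewrite ?undup_uniq// => x; rewrite mem_undup.
Qed.

Lemma cofinallyS T (P Q : seq T -> Prop) : (forall F, uniq F -> P F -> Q F) ->
  cofinally P -> cofinally Q.
Proof. by move=> PQ [F PF]; exists F => G uG sG; apply: PQ => //; exact: PF. Qed.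

Lemma cofinally_sup T (F0 : seq T) : cofinally (fun F => {subset F0 <= F}).
Proof. by exists F0. Qed.

Lemma hassumC_unique T (h : T -> R[i]) s s' : hassumC h s -> hassumC h s' -> s = s'.
Proof.
move=> hs hs'; apply/eqP; rewrite -subr_eq0; apply/eqP; apply: cabs_small => e e0.
have e20 : 0 < e / 2 by lra.
have [F uF [A B]] := cofinally_ex (cofinallyI (hs _ e20) (hs' _ e20)).
have := cabs_distD (\sum_(x <- F) h x) s s'.
rewrite (cabs_distC s (\sum_(x <- F) h x)); lra.
Qed.

Lemma hassumC_lin T (c : R[i]) (h k : T -> R[i]) s s' : hassumC h s -> hassumC k s' ->
  hassumC (fun t => c * h t + k t) (c * s + s').
Proof.
move=> hs ks e e0; have c0 := cabs_ge0 c.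
have d0 : 0 < e / (2 * (cabs c + 1)) by rewrite divr_gt0//; lra.
have e20 : 0 < e / 2 by lra.
apply: cofinallyS (cofinallyI (hs _ d0) (ks _ e20)) => F uF [A B].
rewrite big_split /= -mulr_sumr opprD addrACA -mulrBr (le_lt_trans (cabsD _ _))//.
rewrite cabsM; suff : cabs c * cabs (\sum_(x <- F) h x - s) <= e / 2 by lra.
apply: (@le_trans _ _ ((cabs c + 1) * (e / (2 * (cabs c + 1))))).
  by apply: ler_pM; rewrite ?cabs_ge0 ?(ltW A)// lerDl.
rewrite le_eqVlt; apply/orP; left; apply/eqP; field; lra.
Qed.

Lemma hassumC_eq T (h k : T -> R[i]) s : h =1 k -> hassumC h s -> hassumC k s.
Proof. by move=> /funext ->. Qed.

Lemma hassumC_fin T (h : T -> R[i]) (E : seq T) : uniq E ->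
  (forall t, t \notin E -> h t = 0) -> hassumC h (\sum_(t <- E) h t).
Proof.
move=> uE h0 e e0; exists E => F uF sF.
rewrite (bigID (mem E)) /= [X in _ + X - _]big1 ?addr0//.
rewrite -big_filter (perm_big E) ?subrr ?cabs0//.
apply: uniq_perm; rewrite ?filter_uniq// => t; rewrite mem_filter andb_idr//; exact: sF.
Qed.

Lemma hassumC0 T : hassumC (fun _ : T => 0 : R[i]) 0.
Proof. by have := @hassumC_fin T (fun=> 0) [::] isT; rewrite big_nil; apply. Qed.

Lemma hassumCZ T (c : R[i]) (h : T -> R[i]) s : hassumC h s -> hassumC (fun t => c * h t) (c * s).
Proof.
move=> /(hassumC_lin c)/(_ (hassumC0 T)); rewrite addr0; apply: hassumC_eq => t.
by rewrite addr0.
Qed.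

Lemma hassumCD T (h k : T -> R[i]) s s' : hassumC h s -> hassumC k s' ->
  hassumC (fun t => h t + k t) (s + s').
Proof.
move=> hs /(hassumC_lin 1 hs); rewrite mul1r; apply: hassumC_eq => t.
by rewrite mul1r.
Qed.

Lemma hassumC_mass T (a : T -> R) M : (forall t, 0 <= a t) -> sums_le a M ->
  hassumC (fun t => (a t)%:C) (mass a)%:C.
Proof.
move=> a0 aM; have [S [aS near_S]] := sums_le_sup a0 aM.
have SE : S = mass a.
  apply/eqP; rewrite eq_le mass_le// andbT; apply/ler_addgt0Pr => e e0.
  have [F uF] := near_S _ e0; have := sums_le_mass a0 aM uF; lra.
move=> e e0; have [F0 uF0] := near_S _ e0; rewrite SE => ltF0.
exists F0 => F uF sF.
rewrite -rmorph_sum -rmorphB cabs_real ltr_norml.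
have := sums_le_mass a0 aM uF; have := sum_subseq a0 uF0 uF sF; lra.
Qed.

(** The real and the imaginary part are each of the form [(cabs h + part) - cabs h], a difference of
    nonnegative families with bounded sums. *)
Lemma hassumC_abs T (h : T -> R[i]) M :
  sums_le (fun t => cabs (h t)) M -> exists s, hassumC h s.
Proof.
move=> hM; have abs_h := hassumC_mass (fun t => cabs_ge0 (h t)) hM.
have part (k : R[i] -> R) : (forall z, `|k z| <= cabs z) ->
    exists s, hassumC (fun t => (k (h t))%:C) s.
  move=> k_le; have k0 t : 0 <= cabs (h t) + k (h t).
    by have := k_le (h t); rewrite ler_norml; lra.
  have kM : sums_le (fun t => cabs (h t) + k (h t)) (M + M).
    apply: sums_leW (sums_leD hM hM) => // t; rewrite lerD2l.
    by apply: le_trans (k_le _); exact: ler_norm.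
  eexists; apply: hassumC_eq (hassumC_lin (-1) abs_h (hassumC_mass k0 kM)) => t.
  by rewrite rmorphD; ring.
have [s1 re] := part (@complex.Re R) (@ler_Re_cabs R).
have [s2 im] := part (@complex.Im R) (@ler_Im_cabs R).
exists ('i * s2 + s1); apply: hassumC_eq (hassumC_lin 'i im re) => t.
by rewrite addrC -complexE.
Qed.

Lemma hassumC_le T (h : T -> R[i]) M s :
  sums_le (fun t => cabs (h t)) M -> hassumC h s -> cabs s <= M.
Proof.
move=> hM hs; apply/ler_addgt0Pr => e e0.
have [F uF hF] := cofinally_ex (hs _ e0).
have := hM _ uF; have := cabs_sum F h.
have := cabs_distD (\sum_(t <- F) h t) s 0; rewrite !subr0 cabs_distC; lra.
Qed.

Lemma hassumC_sigma T U (h : T * U -> R[i]) (g : T -> R[i]) s : hassumC h s ->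
  (forall t, hassumC (fun u => h (t, u)) (g t)) -> hassumC g s.
Proof.
move=> hs hg e e0; have e20 : 0 < e / 2 by lra.
have [F0 sF0] := hs _ e20.
exists (undup (map fst F0)) => F uF sF.
(* Half of the error is shared among the inner sums; the successor covers an empty [F]. *)
pose d := e / 2 / (size F).+1%:R.
have d0 : 0 < d by rewrite divr_gt0.
have /choice[L Lg] : forall t, exists L : seq U, [/\ uniq L, {subset map snd F0 <= L} &
    cabs (\sum_(u <- L) h (t, u) - g t) < d].
  move=> t; have [L uL [A B]] := cofinally_ex (cofinallyI (hg t _ d0) (cofinally_sup (map snd F0))).
  by exists L.
have {}sF0 : cabs (\sum_(t <- F) \sum_(u <- L t) h (t, u) - s) < e / 2.
  rewrite -(big_allpairs_dep (op := +%R)) -[X in cabs (X - _)]/(\sum_(x <- _) _).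
  rewrite (eq_bigr h) => [|[]//]; apply: sF0.
    apply: allpairs_uniq_dep => //; first by move=> t _; have [] := Lg t.
    by move=> [? ?] [? ?] _ _ [-> ->].
  move=> [t u] tuF; apply/allpairsPdep; exists t, u; split=> //.
    by apply: sF; rewrite mem_undup; apply/mapP; exists (t, u).
  by have [_ + _] := Lg t; apply; apply/mapP; exists (t, u).
apply: (le_lt_trans (cabs_distD (\sum_(t <- F) \sum_(u <- L t) h (t, u)) _ _)).
suff : cabs (\sum_(i <- F) g i - \sum_(t <- F) \sum_(u <- L t) h (t, u)) <= e / 2 by lra.
rewrite -sumrB (le_trans (cabs_sum _ _))//.
apply: (@le_trans _ _ (\sum_(t <- F) d)).
  by apply: ler_sum => t _; rewrite cabs_distC; have [_ _ /ltW] := Lg t.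
rewrite big_const_seq count_predT iter_addr addr0 -[d *+ _]mulr_natr.
rewrite -(divfK (_ : (size F).+1%:R != 0) (e / 2)) ?pnatr_eq0// -/d.
by apply: ler_wpM2l; [exact: ltW|rewrite ler_nat].
Qed.

(* The summands of [k] are those of [h] moved along [e], apart from zero summands
   on either side. *)
Lemma hassumC_reindex T U (e : T -> U) (h : T -> R[i]) (k : U -> R[i]) s :
  (forall t, h t != 0 -> k (e t) = h t) ->
  (forall t t', h t != 0 -> h t' != 0 -> e t = e t' -> t = t') ->
  (forall u, k u != 0 -> exists2 t, h t != 0 & e t = u) ->
  hassumC h s -> hassumC k s.
Proof.
move=> ke einj ksurj hs eps eps0; have [F0 sF0] := hs _ eps0.
have /choice[d dE] : forall u, exists t : option T, if k u == 0 then t = None else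
    exists2 t', t = Some t' & h t' != 0 /\ e t' = u.
  move=> u; case: eqVneq => [|/ksurj[t ht et]]; first by exists None.
  by exists (Some t), t.
exists (map e F0) => F uF sF; pose G := pmap d F.
have GP t : t \in G -> exists u, [/\ u \in F, k u != 0, h t != 0 & e t = u].
  rewrite mem_pmap => /mapP[u uF' dt]; exists u.
  by have := dE u; case: eqVneq => [_|_]; rewrite -dt // => -[t' [->] []].
have uG : uniq G.
  rewrite /G; elim: F uF {sF G GP} => //= u F IH /andP[uF /IH {}IH].
  have := dE u; case: eqVneq => [_ -> //|ku [t -> [ht etu]]] /=.
  rewrite IH andbT; apply/negP; rewrite mem_pmap => /mapP[u' u'F].
  have := dE u'; case: eqVneq => [_ -> //|ku' [t' -> [ht' etu']]] [tt'].
  by move: uF; rewrite -etu tt' etu' u'F.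
have -> : \sum_(u <- F) k u = \sum_(t <- G) h t.
  rewrite /G; elim: F {uF sF G GP uG} => [|u F IH]; rewrite ?big_nil// big_cons IH /=.
  have := dE u; case: eqVneq => [-> -> /=|ku [t -> [ht <-]] /=]; first by rewrite add0r.
  by rewrite big_cons ke.
have hG t : t \in F0 -> h t != 0 -> t \in G.
  move=> tF0 ht; rewrite mem_pmap; apply/mapP; exists (e t); first exact/sF/map_f.
  have := dE (e t); rewrite ke// (negPf ht) => -[t' -> [ht' /(einj _ _ ht' ht) ->]].
  by [].
have := sF0 (G ++ [seq t <- undup F0 | t \notin G]).
rewrite big_cat /= [X in _ + X - _]big_filter [X in _ + X - _]big_seq_cond [X in _ + X - _]big1.
  rewrite addr0; apply.
    rewrite cat_uniq uG filter_uniq ?undup_uniq// andbT /=.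
    by apply/hasPn => t; rewrite mem_filter => /andP[].
  by move=> t tF0; rewrite mem_cat mem_filter mem_undup tF0 andbT orbN.
move=> t /andP[]; rewrite mem_undup => tF0 tG.
by apply/eqP; apply: contraNT tG; exact: hG.
Qed.

End Unconditional.

Section MoreSums.
Context {R : realType}.
Implicit Types (T U : choiceType).

Lemma sums_le_curry T U (a : T * U -> R) M : (forall z, 0 <= a z) -> sums_le a M ->
  sums_le (fun t => fine (\esum_(u in [set: U]) (a (t, u))%:E)) M.
Proof.
move=> a0 aM; have a_t t : sums_le (fun u => a (t, u)) M.
  by apply: sums_le_inj aM => u u' [].
have a_t0 t u : 0 <= a (t, u) by [].
have fin t := (sums_le_fin (a_t0 t) (a_t t)).1.
have esum0 t : (0 <= \esum_(u in [set: U]) (a (t, u))%:E)%E.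
  by apply: esum_ge0 => u _; rewrite lee_fin.
apply/sums_le_esum => [t|]; first exact: fine_ge0.
under eq_esum => t _ do rewrite fineK ?ge0_fin_numE//.
rewrite esum_esum => [|t u _ _]; last by rewrite lee_fin.
rewrite (_ : [set: T] `*`` _ = [set: T * U])%classic; last by apply/seteqP; split.
under eq_esum => z _ do rewrite -surjective_pairing.
exact/sums_le_esum.
Qed.

(** Outside a finite set [F n] all values are at most [1/(n+1)], so every nonzero value is attained
    inside one of these sets. *)
Lemma sums_le_countable T (a : T -> R) M : (forall t, 0 <= a t) -> sums_le a M ->
  countable [set t | a t != 0]%classic.
Proof.
move=> a0 aM.
have n0 n : 0 < n.+1%:R^-1 :> R by rewrite invr_gt0.
have /choice[F FP] n : exists F0 : seq T,
    sums_le (fun t => if t \in F0 then 0 else a t) n.+1%:R^-1.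
  by have [F0 _ ?] := sums_le_tail a0 aM (n0 n); exists F0.
apply: (@sub_countable _ _ _ (\bigcup_n [set` F n])%classic).
  apply: subset_card_le => t /= at0; apply: contrapT => nF.
  have atn n : a t <= n.+1%:R^-1.
    have := sums_le1 t (FP n); case: ifPn => // tF; case: nF.
    by exists n.
  have at_gt0 : 0 < a t by rewrite lt_neqAle eq_sym at0 a0.
  have := archi_boundP (ltW (divr_gt0 ltr01 at_gt0)).
  set n := Num.bound _ => an; have := atn n.
  apply/negP; rewrite -ltNge invf_plt ?posrE// (lt_trans _ (_ : n%:R < _))//.
    by rewrite -[_^-1]mul1r.
  by rewrite ltr_nat.
by apply: bigcup_countable => // n _; exact: finite_set_countable (finite_seq _).
Qed.

Lemma sums_le_pinj T U (d : U -> option T) (a : T -> R) M :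
  (forall u u' t, d u = Some t -> d u' = Some t -> u = u') ->
  sums_le a M -> sums_le (fun u => oapp a 0 (d u)) M.
Proof.
move=> dinj aM F uF.
have -> : \sum_(u <- F) oapp a 0 (d u) = \sum_(t <- pmap d F) a t.
  elim: F {uF} => [|u F IH]; rewrite ?big_nil// big_cons IH /=.
  by case: (d u) => [t|] /=; rewrite ?big_cons ?add0r.
apply: aM; elim: F uF => //= u F IH /andP[uF /IH {}IH].
case E: (d u) => [t|] //=; rewrite IH andbT mem_pmap.
by apply/negP => /mapP[u' u'F /esym/(dinj _ _ _ E) uu']; rewrite uu' u'F in uF.
Qed.

(* Hölder's inequality for finite sums *)
End MoreSums.

Section Holder.
Context {R : realType}.
Variables p q : R.
Hypotheses (p0 : 0 < p) (q0 : 0 < q) (pq : p^-1 + q^-1 = 1).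

(** Young's inequality for [a / A] and [b / B]; a zero bound is treated apart, since it forces every
    product to vanish. *)
Lemma holder_seq (T : eqType) (F : seq T) (a b : T -> R) (A B : R) :
  (forall t, 0 <= a t) -> (forall t, 0 <= b t) -> 0 <= A -> 0 <= B ->
  \sum_(t <- F) a t `^ p <= A `^ p -> \sum_(t <- F) b t `^ q <= B `^ q ->
  \sum_(t <- F) a t * b t <= A * B.
Proof.
have vanish (c : T -> R) (s : R) : 0 < s -> \sum_(t <- F) c t `^ s <= 0 `^ s ->
    forall t, t \in F -> c t = 0.
  move=> s0; rewrite powR0 ?gt_eqF// => c0 t tF; apply: (@powR_eq0_eq0 _ _ s).
  have : \sum_(t <- F) c t `^ s == 0.
    by rewrite eq_le c0 sumr_ge0// => ? _; exact: powR_ge0.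
  rewrite psumr_eq0 => [|? _]; last exact: powR_ge0.
  by move=> /allP/(_ _ tF); rewrite implyTb; move/eqP.
move=> a0 b0; rewrite le_eqVlt => /predU1P[<- _ /(vanish _ _ p0) az _|A0].
  by rewrite mul0r big_seq big1// => t /az ->; rewrite mul0r.
rewrite le_eqVlt => /predU1P[<- _ /(vanish _ _ q0) bz|B0].
  by rewrite mulr0 big_seq big1// => t /bz ->; rewrite mulr0.
have normalize (c : T -> R) (C s : R) : 0 < C -> (forall t, 0 <= c t) ->
    \sum_(t <- F) c t `^ s <= C `^ s -> \sum_(t <- F) (c t / C) `^ s <= 1.
  move=> C0 c0 cC; rewrite -(ler_pM2r (powR_gt0 s C0)) mul1r mulr_suml.
  rewrite (eq_bigr (fun t => c t `^ s))// => t _.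
  by rewrite -powRM ?divfK ?gt_eqF// ?divr_ge0// ltW.
move=> /(normalize _ _ _ A0 a0) aA /(normalize _ _ _ B0 b0) bB.
rewrite (eq_bigr (fun t => (a t / A * (b t / B)) * (A * B))); last first.
  by move=> t _; field; rewrite !gt_eqF.
rewrite -mulr_suml ler_piMl ?(mulr_ge0 (ltW A0) (ltW B0))//.
apply: (@le_trans _ _ (\sum_(t <- F) ((a t / A) `^ p / p + (b t / B) `^ q / q))).
  by apply: ler_sum => t _; apply: conjugate_powR; rewrite // divr_ge0// ltW.
by rewrite big_split -!mulr_suml /= -pq lerD// ler_piMl// invr_ge0 ltW.
Qed.

End Holder.

(** * Group identities from the left-sided axioms *)

Section Group.
Variable G : dgroup.
Implicit Types x y z : G.

Lemma gmulKV x y : gmul (ginv x) (gmul x y) = y.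
Proof. by rewrite gmulA gmulV gmul1. Qed.

Lemma gmulVr x : gmul x (ginv x) = gone G.
Proof.
rewrite -[gmul x _]gmul1 -{1}(gmulV (ginv x)) -gmulA [gmul _ (gmul x _)]gmulA.
by rewrite gmulV gmul1 gmulV.
Qed.

Lemma gmulr1 x : gmul x (gone G) = x.
Proof. by rewrite -(gmulV x) gmulA gmulVr gmul1. Qed.

Lemma gmulVKr x y : gmul x (gmul (ginv x) y) = y.
Proof. by rewrite gmulA gmulVr gmul1. Qed.

Lemma gmulI x : injective (gmul x).
Proof. by move=> y z /(congr1 (gmul (ginv x))); rewrite !gmulKV. Qed.

Lemma gmulVI y z : gmul (ginv y) z = gone G -> z = y.
Proof. by move=> /(congr1 (gmul y)); rewrite gmulVKr gmulr1. Qed.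

Lemma ginvK x : ginv (ginv x) = x.
Proof. by apply: (@gmulI (ginv x)); rewrite gmulV gmulVr. Qed.

Lemma ginvM x y : ginv (gmul x y) = gmul (ginv y) (ginv x).
Proof.
by apply: (@gmulI (gmul x y)); rewrite gmulVr -gmulA gmulVKr gmulVr.
Qed.

End Group.

(** * Upper bounds for [lp] norms *)

Section LpBound.
Context {R : realType} {G : dgroup}.
Implicit Types (s A : R) (f : G -> R[i]).

(** [A] is an upper bound for the norm. Its sign is recorded because the power of a negative number
    is only a default value. *)
Definition lp_le s f A := 0 <= A /\ sums_le (fun x => cabs (f x) `^ s) (A `^ s).

Lemma lp_le_pnorm s f A : 0 < s -> lp_le s f A -> inLp s f /\ pnorm s f <= A.
Proof.
move=> s0 [A0 fA].
have [fin le] := sums_le_fin (fun x => powR_ge0 (cabs (f x)) s) fA.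
split=> //; rewrite /pnorm -[leRHS](powRr1 A0) -[X in _ <= _ `^ X](mulfV (lt0r_neq0 s0)).
rewrite powRrM; apply: ge0_ler_powR => //; first by rewrite invr_ge0 ltW.
  by rewrite nnegrE fine_ge0// esum_ge0// => x _; rewrite lee_fin powR_ge0.
by rewrite nnegrE powR_ge0.
Qed.

Lemma inLp_lp_le s f : 0 < s -> inLp s f -> lp_le s f (pnorm s f).
Proof.
move=> s0 fs; split; first exact: powR_ge0.
rewrite /pnorm -powRrM mulVf ?gt_eqF// powRr1; last first.
  by rewrite fine_ge0// esum_ge0// => x _; rewrite lee_fin powR_ge0.
by apply: esum_fin_sums_le => // x; exact: powR_ge0.
Qed.

Lemma lp_le0 s : 0 < s -> lp_le s (fun=> 0) 0.
Proof.
by move=> s0; split=> // F uF; rewrite big1 ?powR_ge0// => ? _; rewrite cabs0 powR0 ?gt_eqF.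
Qed.

Lemma lp_le_eq0 s f : 0 < s -> lp_le s f 0 -> forall x, f x = 0.
Proof.
move=> s0 [_ f0] x; apply/cabs_eq0/(@powR_eq0_eq0 _ _ s)/eqP.
by rewrite eq_le powR_ge0 andbT; have := sums_le1 x f0; rewrite powR0 ?gt_eqF.
Qed.

Lemma lp_leZ s f A (c : R[i]) : 0 < s -> lp_le s f A -> lp_le s (fun x => c * f x) (cabs c * A).
Proof.
move=> s0 [A0 fA]; split; first by rewrite mulr_ge0 ?cabs_ge0.
rewrite powRM ?cabs_ge0//; apply: sums_leW (sums_leZ (powR_ge0 (cabs c) s) fA) => // x.
by rewrite cabsM powRM ?cabs_ge0.
Qed.

Lemma lp_le_restrict s f A (P : pred G) : 0 < s -> lp_le s f A ->
  lp_le s (fun x => if P x then f x else 0) A.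
Proof.
move=> s0 [A0 fA]; split=> //; apply: sums_leW fA => // x.
by case: ifP; rewrite // cabs0 powR0 ?gt_eqF ?powR_ge0.
Qed.

Lemma lp_le_tail s f A (e : R) : 0 < s -> lp_le s f A -> 0 < e ->
  exists Y : seq G, lp_le s (fun x => if x \in Y then 0 else f x) e.
Proof.
move=> s0 [A0 fA] e0.
have [Y _ Ye] := sums_le_tail (fun x => powR_ge0 (cabs (f x)) s) fA (powR_gt0 s e0).
exists Y; split; first exact: ltW.
by apply: sums_leW Ye => // x; case: ifP; rewrite // cabs0 powR0 ?gt_eqF.
Qed.

Lemma lp_le_delta s (x : G) (c : R[i]) : 0 < s ->
  lp_le s (fun y => if y == x then c else 0) (cabs c).
Proof.
move=> s0; split=> [|F uF]; first exact: cabs_ge0.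
rewrite (eq_bigr (fun y => if y == x then cabs c `^ s else 0)); last first.
  by move=> y _; case: ifP; rewrite // cabs0 powR0 ?gt_eqF.
rewrite -big_mkcond -big_filter (_ : [seq y <- F | y == x] = if x \in F then [:: x] else [::]).
  by case: ifP; rewrite ?big_seq1// big_nil powR_ge0.
case: ifPn => [xF|/negP xF]; first by rewrite filter_pred1_uniq.
by apply/eqP; rewrite -[_ == _]negbK -has_filter; apply/hasPn => y yF; apply: contra_notN xF => /eqP <-.
Qed.

(* Summing over the translations [t] as well gives [||f||_p^p ||h||_p^p]: this is why
   the product of two elements of [Ap] has the right norm. *)
Lemma lp_le_translates s f h A (C : R) : 0 < s -> lp_le s f A -> lp_le s h C ->
  exists D : G -> R,
    (forall t, lp_le s (fun y => f y * h (gmul y t)) (D t)) /\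
    sums_le (fun t => D t `^ s) ((A * C) `^ s).
Proof.
move=> s0 [A0 fA] [C0 hC].
pose w (z : G * G) := cabs (f z.2 * h (gmul z.2 z.1)) `^ s.
have w0 z : 0 <= w z by exact: powR_ge0.
have wM : sums_le w ((A * C) `^ s).
  (* With [y] outermost, the inner sum over [t] is bounded by that of [h], because [t |-> y t] is
     injective. *)
  have : sums_le (fun z : G * G => w (z.2, z.1)) ((A * C) `^ s).
    apply: (@sums_le_prod _ _ _ _ (fun y => C `^ s * cabs (f y) `^ s)) => //.
      move=> y; rewrite mulrC.
      apply: sums_leW (sums_leZ (powR_ge0 _ s) (sums_le_inj (@gmulI _ y) hC)) => // t.
      by rewrite /w cabsM powRM ?cabs_ge0.
    by rewrite powRM// mulrC; apply: sums_leZ => //; exact: powR_ge0.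
  by move=> /(sums_le_inj (e := fun z => (z.2, z.1))); apply => -[? ?] [? ?] [-> ->].
pose S t := fine (\esum_(y in [set: G]) (w (t, y))%:E).
have S0 t : 0 <= S t by rewrite fine_ge0// esum_ge0// => y _; rewrite lee_fin.
have powS t : (S t `^ s^-1) `^ s = S t.
  by rewrite -powRrM mulVf ?gt_eqF// powRr1.
exists (fun t => S t `^ s^-1); split=> [t|].
  split; first exact: powR_ge0.
  rewrite powS; apply: esum_fin_sums_le => [y|]; first exact: powR_ge0.
  have wt : sums_le (fun y => w (t, y)) ((A * C) `^ s).
    by apply: sums_le_inj wM => ? ? [].
  exact: (sums_le_fin (fun y => w0 (t, y)) wt).1.
by apply: sums_leW (sums_le_curry w0 wM) => // t; rewrite powS.
Qed.

End LpBound.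

(** * The Herz algebra: representations, norm and products *)

Section HerzAlgebra.
Context {R : realType} {G : dgroup}.
Variable p : R.
Hypothesis hp : 1 < p.
Local Notation q := (conj_exp p).
Implicit Types (f g : G -> R[i]) (u v w : G -> R[i]) (x y : G).

Let p0 : 0 < p. Proof. exact: lt_trans hp. Qed.

Let q0 : 0 < q. Proof. by rewrite /conj_exp divr_gt0// subr_gt0. Qed.

Let pq : p^-1 + q^-1 = 1.
Proof. by rewrite /conj_exp invf_div; field; rewrite gt_eqF. Qed.

Lemma lp_holder f g A B : lp_le p f A -> lp_le q g B ->
  sums_le (fun y => cabs (g y * f y)) (A * B).
Proof.
move=> [A0 fA] [B0 gB] F uF; under eq_bigr do rewrite cabsM mulrC.
by apply: (holder_seq p0 q0 pq) => // [?|?||]; rewrite ?cabs_ge0 ?fA ?gB.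
Qed.

Lemma lp_le_shift f A x : lp_le p f A -> lp_le p (fun y => f (gmul (ginv x) y)) A.
Proof. by move=> [A0 fA]; split; [exact: A0|]; exact: (sums_le_inj (@gmulI _ (ginv x)) fA). Qed.

(** Hölder makes the family summable, so the value chosen by [tsumC] is its sum and not the default
    [0]. The argument of [f] comes from [(y^-1 x)^-1 = x^-1 y]. *)
Lemma hassum_conv f g A B x : lp_le p f A -> lp_le q g B ->
  hassumC (fun y => g y * f (gmul (ginv x) y)) (Defs.conv g (check f) x).
Proof.
move=> fA gB; have [s hs] := hassumC_abs (lp_holder (lp_le_shift x fA) gB).
apply: (hassumC_eq (h := fun y => g y * check f (gmul (ginv y) x))) => [y|].
  by rewrite /check ginvM ginvK.
apply: xgetPex; exists s; apply: hassumC_eq hs => y.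
by rewrite /check ginvM ginvK.
Qed.

(* Like [Ap_rep], but over an arbitrary index type and with upper bounds [a], [b] for
   the norms; the sum over indices and the sum defining each convolution are merged. *)
Definition Ap_sum (T : choiceType) (f g : T -> G -> R[i]) (a b : T -> R) (r : R) u :=
  [/\ forall t, lp_le p (f t) (a t), forall t, lp_le q (g t) (b t),
      sums_le (fun t => a t * b t) r
    & forall x, hassumC (fun z : T * G => g z.1 z.2 * f z.1 (gmul (ginv x) z.2)) (u x)].

Lemma Ap_sums_le (T : choiceType) (f g : T -> G -> R[i]) (a b : T -> R) (r : R) x :
  (forall t, lp_le p (f t) (a t)) -> (forall t, lp_le q (g t) (b t)) ->
  sums_le (fun t => a t * b t) r ->
  sums_le (fun z : T * G => cabs (g z.1 z.2 * f z.1 (gmul (ginv x) z.2))) r.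
Proof.
move=> fa gb abr; apply: (sums_le_prod _ _ abr) => [z|t]; first exact: cabs_ge0.
exact: lp_holder (lp_le_shift x (fa t)) (gb t).
Qed.

(** The merged family is absolutely summable, so its sum exists and can only be the iterated one. *)
Lemma Ap_sumI (T : choiceType) (f g : T -> G -> R[i]) (a b : T -> R) (r : R) u c :
  (forall t, lp_le p (f t) (a t)) -> (forall t, lp_le q (g t) (b t)) ->
  sums_le (fun t => a t * b t) r ->
  (forall t x, hassumC (fun y => g t y * f t (gmul (ginv x) y)) (c t x)) ->
  (forall x, hassumC (c ^~ x) (u x)) -> Ap_sum f g a b r u.
Proof.
move=> fa gb abr gfc cu; split=> // x.
have [s hs] := hassumC_abs (Ap_sums_le x fa gb abr).
by rewrite (hassumC_unique (cu x) (hassumC_sigma hs (fun t => gfc t x))).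
Qed.

Lemma Ap_sumE (T : choiceType) (f g : T -> G -> R[i]) (a b : T -> R) (r : R) u x :
  Ap_sum f g a b r u -> hassumC (fun t => Defs.conv (g t) (check (f t)) x) (u x).
Proof.
move=> [fa gb _ /(_ x) hu]; apply: hassumC_sigma hu _ => t.
exact: hassum_conv (fa t) (gb t).
Qed.


Lemma Ap_cost_lbound u : lbound [set r : R | exists f g : nat -> G -> R[i], Ap_rep p f g u /\
  r = fine (\esum_(i in [set: nat]) (pnorm p (f i) * pnorm q (g i))%:E)]%classic 0.
Proof.
move=> _ [f [g [_ ->]]]; rewrite fine_ge0// esum_ge0// => n _.
by rewrite lee_fin mulr_ge0 ?powR_ge0.
Qed.

Lemma Apnorm_ge0 u : 0 <= Apnorm p u.
Proof.
have [E0|/set0P E0] := eqVneq [set r : R | exists f g : nat -> G -> R[i], Ap_rep p f g u /\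
    r = fine (\esum_(i in [set: nat]) (pnorm p (f i) * pnorm q (g i))%:E)]%classic set0.
  (* Without any representation the set of costs is empty, and its infimum is [0] by convention. *)
  by rewrite /Apnorm E0 inf0.
exact: lb_le_inf E0 (@Ap_cost_lbound u).
Qed.

Lemma Ap_sum_nat u r : Ap p u -> Apnorm p u < r ->
  exists (f g : nat -> G -> R[i]) a b, Ap_sum f g a b r u.
Proof.
move=> [f0 [g0 rep0]] ltr.
have [|_ [f [g [rep ->]]] lt_r] := inf_lt _ ltr.
  by eexists; exists f0, g0; split; first exact: rep0.
have [inLps fin hu] := rep.
have fa n := inLp_lp_le p0 (inLps n).1; have gb n := inLp_lp_le q0 (inLps n).2.
exists f, g, (fun n => pnorm p (f n)), (fun n => pnorm q (g n)).
have cost0 n : 0 <= pnorm p (f n) * pnorm q (g n) by rewrite mulr_ge0 ?powR_ge0.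
have cost_r := sums_leW (fun n => lexx _) (ltW lt_r) (esum_fin_sums_le cost0 fin).
exact: Ap_sumI fa gb cost_r (fun n x => hassum_conv x (fa n) (gb n)) hu.
Qed.

(** If [a t * b t = 0], then [f t] or [g t] vanishes and the term contributes nothing. The other
    indices are countable; [d] is the partial inverse of their enumeration [code], and numbers
    outside its range receive zero functions. *)
Lemma Ap_sum_Ap (T : choiceType) (f g : T -> G -> R[i]) (a b : T -> R) (r : R) u :
  Ap_sum f g a b r u -> Ap p u /\ Apnorm p u <= r.
Proof.
move=> S; have [fa gb abr _] := S.
have a0 t := (fa t).1; have b0 t := (gb t).1.
have ab0 t : 0 <= a t * b t by exact: mulr_ge0.
have /countable_injP[code code_inj] := sums_le_countable ab0 abr.
have /choice[d dP] n : exists o : option T, if o is Some t then a t * b t != 0 /\ code t = n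
    else forall t, a t * b t != 0 -> code t <> n.
  have [[t [nz tn]]|no] := pselect (exists t, a t * b t != 0 /\ code t = n).
    by exists (Some t).
  by exists None => t nz tn; apply: no; exists t.
have d_code t : a t * b t != 0 -> d (code t) = Some t.
  move=> nz; have := dP (code t); case: (d _) => [t' [nz' /code_inj ->]|/(_ t nz)//];
    by rewrite ?inE.
pose f' n := oapp f (fun=> 0) (d n); pose g' n := oapp g (fun=> 0) (d n).
have f'a n : lp_le p (f' n) (oapp a 0 (d n)).
  by rewrite /f'; case: (d n) => [t|] /=; [exact: fa|exact: lp_le0].
have g'b n : lp_le q (g' n) (oapp b 0 (d n)).
  by rewrite /g'; case: (d n) => [t|] /=; [exact: gb|exact: lp_le0].
have bound : sums_le (fun n => pnorm p (f' n) * pnorm q (g' n)) r.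
  apply: sums_leW (lexx _) (sums_le_pinj (d := d) _ abr) => [n|n n' t dn dn'].
    have -> : oapp (fun t => a t * b t) 0 (d n) = oapp a 0 (d n) * oapp b 0 (d n).
      by case: (d n) => /=; rewrite ?mulr0.
    by rewrite ler_pM ?powR_ge0//; [case: (lp_le_pnorm p0 (f'a n))|case: (lp_le_pnorm q0 (g'b n))].
  by have := dP n; have := dP n'; rewrite dn dn' => -[_ <-] [_ <-].
have [fin le_r] := sums_le_fin (fun n => mulr_ge0 (powR_ge0 _ _) (powR_ge0 _ _)) bound.
have rep : Ap_rep p f' g' u.
  split=> [n|//|x].
    by split; [case: (lp_le_pnorm p0 (f'a n))|case: (lp_le_pnorm q0 (g'b n))].
  have conv0 t : Defs.conv (g t) (check (f t)) x != 0 -> a t * b t != 0.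
    apply: contraNneq => /eqP; rewrite mulf_eq0 => ab; apply/eqP.
    apply: hassumC_unique (hassum_conv x (fa t) (gb t)) _.
    apply: hassumC_eq (hassumC0 _) => y.
    case/orP: ab => /eqP z; [have := fa t|have := gb t]; rewrite z => /lp_le_eq0 -> //.
      by rewrite mulr0.
    by rewrite mul0r.
  apply: (hassumC_reindex (e := code)) (Ap_sumE x S) => [t /conv0 /d_code||n].
  - by rewrite /f' /g' => ->.
  - by move=> t t' /conv0 nz /conv0 nz' /code_inj; apply; rewrite inE.
  - have := dP n; rewrite /f' /g'; case: (d n) => [t [_ tn] /= nz|_ /=]; first by exists t.
    suff -> : Defs.conv (fun=> 0) (check (fun=> 0)) x = 0 :> R[i] by rewrite eqxx.
    apply: hassumC_unique (hassum_conv x (lp_le0 p0) (lp_le0 q0)) _.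
    by apply: hassumC_eq (hassumC0 _) => y; rewrite mulr0.
split; first by exists f', g'.
apply: le_trans le_r; apply: ge_inf; first by exists 0; exact: Ap_cost_lbound.
by exists f', g'.
Qed.

(** Takes the place of completeness. The strict bounds leave room to choose a representation of each
    [w i] of cost at most [r i]; joined together, these represent [u]. *)
Lemma Ap_countable_sum (I : choiceType) (w : I -> G -> R[i]) (r : I -> R) M u :
  (forall i, Ap p (w i)) -> (forall i, Apnorm p (w i) < r i) -> sums_le r M ->
  (forall x, hassumC (w ^~ x) (u x)) -> Ap p u /\ Apnorm p u <= M.
Proof.
move=> wA wr rM wu.
have /choice[f /choice[g /choice[a /choice[b S]]]] := fun i => Ap_sum_nat (wA i) (wr i).
pose F (t : I * nat) := f t.1 t.2; pose K (t : I * nat) := g t.1 t.2.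
pose A (t : I * nat) := a t.1 t.2; pose B (t : I * nat) := b t.1 t.2.
have FA t : lp_le p (F t) (A t) by have [fa _ _ _] := S t.1; exact: fa.
have KB t : lp_le q (K t) (B t) by have [_ gb _ _] := S t.1; exact: gb.
have ABM : sums_le (fun t => A t * B t) M.
  apply: (sums_le_prod _ _ rM) => [t|i]; last by have [_ _ abr _] := S i; exact: abr.
  by rewrite mulr_ge0 ?(FA t).1 ?(KB t).1.
apply: (@Ap_sum_Ap _ F K A B); split=> // x.
have [s hs] := hassumC_abs (Ap_sums_le x FA KB ABM).
suff -> : u x = s by [].
apply: hassumC_unique (wu x) _.
apply: (hassumC_sigma (h := fun z : I * (nat * G) =>
  g z.1 z.2.1 z.2.2 * f z.1 z.2.1 (gmul (ginv x) z.2.2))) => [|i].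
  apply: (hassumC_reindex (e := fun z : (I * nat) * G => (z.1.1, (z.1.2, z.2)))) hs => //.
    by move=> [[? ?] ?] [[? ?] ?] _ _ [-> -> ->].
  by move=> [i [n y]] nz; exists ((i, n), y).
by have [_ _ _ hw] := S i; exact: hw.
Qed.

Lemma Ap_add u v : Ap p u -> Ap p v ->
  Ap p (fun x => u x + v x) /\ Apnorm p (fun x => u x + v x) <= Apnorm p u + Apnorm p v.
Proof.
move=> uA vA.
have H e : 0 < e -> Ap p (fun x => u x + v x) /\
    Apnorm p (fun x => u x + v x) <= Apnorm p u + Apnorm p v + e.
  move=> e0; apply: (@Ap_countable_sum bool (fun i => if i then u else v)
    (fun i => (if i then Apnorm p u else Apnorm p v) + e / 2)).
  - by case.
  - by case; lra.
  - move=> F uF; apply: (le_trans (sum_subseq (G := [:: true; false]) _ uF _ _)) => //.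
    + by case; rewrite addr_ge0 ?Apnorm_ge0//; lra.
    + by case; rewrite !inE.
    + by rewrite !big_cons big_nil; lra.
  - move=> x; have := @hassumC_fin _ _ (fun i : bool => (if i then u else v) x) [:: true; false].
    by rewrite !big_cons big_nil addr0; apply=> //; case.
split; first by case: (H 1).
by apply/ler_addgt0Pr => e /H[].
Qed.

Lemma Ap_scale c u : Ap p u ->
  Ap p (fun x => c * u x) /\ Apnorm p (fun x => c * u x) <= cabs c * Apnorm p u.
Proof.
move=> uA.
have H e : 0 < e -> Ap p (fun x => c * u x) /\
    Apnorm p (fun x => c * u x) <= cabs c * (Apnorm p u + e).
  move=> e0; have [|f [g [a [b [fa gb abr hu]]]]] := @Ap_sum_nat u (Apnorm p u + e) uA.
    by rewrite ltrDl.
  apply: (@Ap_sum_Ap _ f (fun n y => c * g n y) a (fun n => cabs c * b n)); split=> //.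
  - by move=> n; exact: lp_leZ.
  - by apply: sums_leW (sums_leZ (cabs_ge0 c) abr) => // n; rewrite mulrCA.
  - by move=> x; apply: hassumC_eq (hassumCZ c (hu x)) => z; rewrite mulrA.
split; first by case: (H 1).
apply/ler_addgt0Pr => e e0; have c0 := cabs_ge0 c.
have d0 : 0 < e / (cabs c + 1) by rewrite divr_gt0//; lra.
have [_ /le_trans] := H _ d0; apply; rewrite mulrDr lerD2l.
by rewrite mulrCA ler_piMr ?(ltW e0)// ler_pdivrMr ?mul1r; lra.
Qed.

Lemma Ap_sub u v : Ap p u -> Ap p v ->
  Ap p (fun x => u x - v x) /\ Apnorm p (fun x => u x - v x) <= Apnorm p u + Apnorm p v.
Proof.
move=> uA vA; have [vA' vn] := Ap_scale (-1) vA; have [] := Ap_add uA vA'.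
have -> : (fun x => u x + -1 * v x) = (fun x => u x - v x).
  by apply/funext => x; rewrite mulN1r.
move=> H H'; split=> //; apply: (le_trans H'); rewrite lerD2l (le_trans vn)//.
by rewrite cabsN cabs1 mul1r.
Qed.

Lemma cabs_le_Apnorm u x : Ap p u -> cabs (u x) <= Apnorm p u.
Proof.
move=> uA; apply/ler_addgt0Pr => e e0.
have [|f [g [a [b [fa gb abr hu]]]]] := @Ap_sum_nat u (Apnorm p u + e) uA.
  by rewrite ltrDl.
exact: hassumC_le (Ap_sums_le x fa gb abr) (hu x).
Qed.

Lemma Ap_conv f g A B : lp_le p f A -> lp_le q g B ->
  Ap p (Defs.conv g (check f)) /\ Apnorm p (Defs.conv g (check f)) <= A * B.
Proof.
move=> fA gB; apply: (@Ap_sum_Ap unit (fun=> f) (fun=> g) (fun=> A) (fun=> B)).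
apply: (Ap_sumI (c := fun _ x => Defs.conv g (check f) x)) => // [|_ x|x].
- have AB0 : 0 <= A * B by rewrite mulr_ge0 ?fA.1 ?gB.1.
  move=> F uF; apply: (le_trans (sum_subseq (G := [:: tt]) _ uF _ _)) => //.
  by rewrite big_seq1.
- exact: hassum_conv fA gB.
- have := @hassumC_fin _ _ (fun=> Defs.conv g (check f) x) [:: tt].
  by rewrite big_seq1; apply=> //; case.
Qed.

(** [u] is the sum of its values times point masses, and the point mass at [t] is its own
    convolution with the one at the identity, at cost [1]. *)
Lemma Ap_finsupp (E : seq G) u : uniq E -> (forall x, x \notin E -> u x = 0) ->
  Ap p u /\ Apnorm p u <= \sum_(x <- E) cabs (u x).
Proof.
move=> uE u0.
apply: (@Ap_sum_Ap _ (fun=> fun y => if y == gone G then 1 else 0)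
  (fun t y => if y == t then u t else 0) (fun=> cabs 1) (fun t => cabs (u t))).
apply: (Ap_sumI (c := fun t x => if t == x then u x else 0)) => [t|t||t x|x].
- exact: lp_le_delta.
- exact: lp_le_delta.
- move=> F uF; apply: (@le_trans _ _ (\sum_(t <- undup (E ++ F)) cabs (u t))).
    under eq_bigr do rewrite cabs1 mul1r.
    apply: sum_subseq; rewrite ?undup_uniq// => t; first exact: cabs_ge0.
    by rewrite mem_undup mem_cat orbC => ->.
  rewrite (bigID (mem E)) /= [X in _ + X]big1 ?addr0 => [|t /u0 ->]; last exact: cabs0.
  rewrite -big_filter; apply: sum_subseq; rewrite ?filter_uniq ?undup_uniq// => t.
    exact: cabs_ge0.
  by rewrite mem_filter => /andP[].
- have := @hassumC_fin _ _ (fun y => (if y == t then u t else 0) *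
    (if gmul (ginv x) y == gone G then 1 else 0)) [:: t] isT.
  rewrite big_seq1 eqxx (_ : _ * _ = if t == x then u x else 0).
    by apply=> y; rewrite inE => /negPf ->; rewrite mul0r.
  case: (eqVneq t x) => [->|tx]; first by rewrite gmulV eqxx mulr1.
  by case: eqP => [/gmulVI/eqP|]; rewrite ?(negPf tx) ?mulr0.
- have := @hassumC_fin _ _ (fun t => if t == x then u x else 0) [:: x] isT.
  by rewrite big_seq1 eqxx; apply=> t; rewrite inE => /negPf ->.
Qed.

(** For fixed [t = y^-1 y'] the product of two summands is the convolution of [y |-> g y * k (y t)]
    with [y |-> f y * h (y t)]. By [lp_le_translates] the bounds [D] and [E] have norms at most
    [a c] and [b d] as functions of [t], and Hölder gives total cost [a b c d]. *)
Lemma Ap_mul u v : Ap p u -> Ap p v ->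
  Ap p (pmul u v) /\ Apnorm p (pmul u v) <= Apnorm p u * Apnorm p v.
Proof.
move=> uA vA.
have H r s : Apnorm p u < r -> Apnorm p v < s -> Ap p (pmul u v) /\ Apnorm p (pmul u v) <= r * s.
  move=> /(Ap_sum_nat uA)[f [g [a [b [fa gb abr hu]]]]].
  move=> /(Ap_sum_nat vA)[h [k [c [d [hc kd cds hv]]]]].
  have r0 := sums_le_ge0 abr.
  have /choice[D /all_and2[DP Dsum]] (t : nat * nat) := lp_le_translates p0 (fa t.1) (hc t.2).
  have /choice[E /all_and2[EP Esum]] (t : nat * nat) := lp_le_translates q0 (gb t.1) (kd t.2).
  pose F (t : (nat * nat) * G) y := f t.1.1 y * h t.1.2 (gmul y t.2).
  pose K (t : (nat * nat) * G) y := g t.1.1 y * k t.1.2 (gmul y t.2).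
  have FD t : lp_le p (F t) (D t.1 t.2) by exact: DP.
  have KE t : lp_le q (K t) (E t.1 t.2) by exact: EP.
  have D0 t : 0 <= D t.1 t.2 := (FD t).1.
  have E0 t : 0 <= E t.1 t.2 := (KE t).1.
  have a0 n := (fa n).1; have b0 n := (gb n).1; have c0 n := (hc n).1; have d0 n := (kd n).1.
  have DEM : sums_le (fun t => D t.1 t.2 * E t.1 t.2) (r * s).
    apply: (@sums_le_prod _ _ _ _ (fun t => (a t.1 * b t.1) * (c t.2 * d t.2))) => [t|t|].
    - by rewrite mulr_ge0.
    - rewrite mulrACA => L uL; apply: (holder_seq p0 q0 pq) => [y|y||||] /=.
      + exact: (D0 (t, y)).
      + exact: (E0 (t, y)).
      + by rewrite mulr_ge0.
      + by rewrite mulr_ge0.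
      + exact: Dsum.
      + exact: Esum.
    - apply: (@sums_le_prod _ _ _ _ (fun n => s * (a n * b n))) => [z|n|].
      + by rewrite !mulr_ge0.
      + rewrite (mulrC s); exact: sums_leZ (mulr_ge0 (a0 n) (b0 n)) cds.
      + rewrite (mulrC r); exact: sums_leZ (sums_le_ge0 cds) abr.
  apply: (@Ap_sum_Ap _ F K (fun t => D t.1 t.2) (fun t => E t.1 t.2)); split=> // x.
  have [S hS] := hassumC_abs (Ap_sums_le x FD KE DEM).
  suff -> : pmul u v x = S by [].
  pose P (z : (nat * G) * (nat * G)) := (g z.1.1 z.1.2 * f z.1.1 (gmul (ginv x) z.1.2)) *
    (k z.2.1 z.2.2 * h z.2.1 (gmul (ginv x) z.2.2)).
  have PS : hassumC P S.
    have KP z : P ((z.1.1.1, z.2), (z.1.1.2, gmul z.2 z.1.2)) =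
        K z.1 z.2 * F z.1 (gmul (ginv x) z.2).
      by rewrite /P /K /F /= gmulA; ring.
    apply: (hassumC_reindex (e := fun z : ((nat * nat) * G) * G =>
        ((z.1.1.1, z.2), (z.1.1.2, gmul z.2 z.1.2)))) hS => [z _||z Pz].
    - exact: KP.
    - by move=> [[[i j] t] y] [[[i' j'] t'] y'] _ _ /= [-> -> -> /gmulI ->].
    - exists ((z.1.1, z.2.1), gmul (ginv z.1.2) z.2.2, z.1.2).
        by rewrite -KP /= gmulVKr -!surjective_pairing.
      by rewrite /= gmulVKr -!surjective_pairing.
  apply: (hassumC_unique _ (hassumC_sigma PS (g := fun z =>
    (g z.1 z.2 * f z.1 (gmul (ginv x) z.2)) * v x) _)).
    by rewrite /pmul mulrC; apply: hassumC_eq (hassumCZ (v x) (hu x)) => z; rewrite mulrC.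
  by move=> z; exact: (hassumCZ (g z.1 z.2 * f z.1 (gmul (ginv x) z.2)) (hv x)).
have nu := Apnorm_ge0 u; have nv := Apnorm_ge0 v.
split; first by case: (H (Apnorm p u + 1) (Apnorm p v + 1)); rewrite ?ltrDl.
apply/ler_addgt0Pr => e e0.
(* Enlarging both norms by [d] increases their product by [d] times their sum plus [d], which is at
   most [e] since [d <= 1]. *)
pose d := Num.min 1 (e / (Apnorm p u + Apnorm p v + 1)).
have N0 : 0 < Apnorm p u + Apnorm p v + 1 by lra.
have d0 : 0 < d by rewrite lt_min ltr01 divr_gt0.
have d1 : d <= 1 by rewrite ge_min lexx.
have dN : d * (Apnorm p u + Apnorm p v + 1) <= e by rewrite -ler_pdivlMr// ge_min lexx orbT.
have [||_ /le_trans] := H (Apnorm p u + d) (Apnorm p v + d); rewrite ?ltrDl//; apply.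
by nra.
Qed.

End HerzAlgebra.

(** * Density of finitely supported functions *)

Section Density.
Context {R : realType} {G : dgroup}.
Variable p : R.
Hypothesis hp : 1 < p.
Local Notation q := (conj_exp p).
Implicit Types (f g : G -> R[i]) (u v w : G -> R[i]) (x y : G).

Let p0 : 0 < p. Proof. exact: lt_trans hp. Qed.

Let q0 : 0 < q. Proof. by rewrite /conj_exp divr_gt0// subr_gt0. Qed.

Definition Apdist u v : R := Apnorm p (fun x => u x - v x).

Lemma Apdist_trans u v w : Ap p u -> Ap p v -> Ap p w ->
  Apdist u w <= Apdist u v + Apdist v w.
Proof.
move=> uA vA wA; have [_] := Ap_add hp (Ap_sub hp uA vA).1 (Ap_sub hp vA wA).1.
apply: le_trans; rewrite le_eqVlt; apply/orP; left; apply/eqP; congr (Apnorm p _).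
by apply/funext => x; ring.
Qed.

Lemma ApdistC u v : Ap p u -> Ap p v -> Apdist u v = Apdist v u.
Proof.
suff H u' v' : Ap p u' -> Ap p v' -> Apdist u' v' <= Apdist v' u'.
  by move=> uA vA; apply/eqP; rewrite eq_le !H.
move=> uA vA; have [_] := Ap_scale hp (-1) (Ap_sub hp vA uA).1.
rewrite cabsN cabs1 mul1r; apply: le_trans.
rewrite le_eqVlt; apply/orP; left; apply/eqP; congr (Apnorm p _).
by apply/funext => x; ring.
Qed.

Lemma Apnorm_le_dist u v : Ap p u -> Ap p v -> Apnorm p u <= Apnorm p v + Apdist u v.
Proof.
move=> uA vA; have [_] := Ap_add hp vA (Ap_sub hp uA vA).1.
apply: le_trans; rewrite le_eqVlt; apply/orP; left; apply/eqP; congr (Apnorm p _).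
by apply/funext => x; ring.
Qed.

Definition supported_in (E : seq G) u := uniq E /\ forall x, x \notin E -> u x = 0.

Definition approximable u := Ap p u /\
  forall e, 0 < e -> exists u1 E, supported_in E u1 /\ Apdist u u1 < e.

Lemma supported_Ap E u : supported_in E u -> Ap p u.
Proof. by case=> uE u0; have [] := Ap_finsupp hp uE u0. Qed.

Lemma approximable_closed u : Ap p u ->
  (forall e, 0 < e -> exists2 w, approximable w & Apdist u w < e) -> approximable u.
Proof.
move=> uA uw; split; [exact: uA|move=> e e0]; have e20 : 0 < e / 2 by lra.
have [w [wA wE] duw] := uw _ e20; have [u1 [E [u1E dwu]]] := wE _ e20.
exists u1, E; split; first exact: u1E.
apply: (le_lt_trans (Apdist_trans uA wA (supported_Ap u1E))); lra.
Qed.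

Lemma approximable_sum (F : seq nat) (w : nat -> G -> R[i]) :
  (forall n, approximable (w n)) -> approximable (fun x => \sum_(n <- F) w n x).
Proof.
move=> wP; elim: F => [|n F [FA FE]].
  rewrite (_ : (fun x => _) = fun=> 0); last by apply/funext => x; rewrite big_nil.
  have z : supported_in [::] (fun=> 0) by split.
  split=> [|e e0]; first exact: supported_Ap z.
  exists (fun=> 0), [::]; split; first exact: z.
  rewrite /Apdist; apply: le_lt_trans e0.
  have [|_] := @Ap_finsupp R G p hp [::] (fun=> 0 - 0) isT.
    by move=> x _; rewrite subrr.
  by rewrite big_nil.
have [nA nE] := wP n.
rewrite (_ : (fun x => _) = (fun x => w n x + \sum_(n <- F) w n x)); last first.
  by apply/funext => x; rewrite big_cons.
split=> [|e e0]; first by have [] := Ap_add hp nA FA.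
have e20 : 0 < e / 2 by lra.
have [u1 [E1 [u1E d1]]] := nE _ e20; have [u2 [E2 [u2E d2]]] := FE _ e20.
exists (fun x => u1 x + u2 x), (undup (E1 ++ E2)); split.
  split=> [|x]; first exact: undup_uniq.
  by rewrite mem_undup mem_cat negb_or => /andP[/u1E.2 -> /u2E.2 ->]; rewrite addr0.
have [_] := Ap_add hp (Ap_sub hp nA (supported_Ap u1E)).1 (Ap_sub hp FA (supported_Ap u2E)).1.
rewrite (_ : (fun x => _) = (fun x => w n x + \sum_(n <- F) w n x - (u1 x + u2 x))); last first.
  by apply/funext => x; ring.
move=> /le_lt_trans; apply; rewrite /Apdist in d1 d2; lra.
Qed.

(** Cutting [f] down to [Y] and [g] to [Z] leaves a function supported in [Z Y^-1]. The error is the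
    convolution of [g1] with [f] plus that of [g2] with [f1], of cost at most
    [A * eta + eta * B]. *)
Lemma approximable_conv f g A B : lp_le p f A -> lp_le q g B ->
  approximable (Defs.conv g (check f)).
Proof.
move=> fA gB; have wA := (Ap_conv hp fA gB).1; split; [exact: wA|move=> e e0].
have A0 := fA.1; have B0 := gB.1.
have AB1 : 0 < A + B + 1 by lra.
have [eta eta0 etaE] : exists2 eta, 0 < eta & eta * (A + B + 1) = e / 2.
  by exists (e / 2 / (A + B + 1)); rewrite ?divfK ?gt_eqF ?divr_gt0.
have [Y fY] := lp_le_tail p0 fA eta0; have [Z gZ] := lp_le_tail q0 gB eta0.
have fY' := lp_le_restrict (mem Y) p0 fA; have gZ' := lp_le_restrict (mem Z) q0 gB.
set f1 := (fun x => if x \in Y then 0 else f x) in fY.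
set g1 := (fun x => if x \in Z then 0 else g x) in gZ.
set f2 := (fun x => if mem Y x then f x else 0) in fY'.
set g2 := (fun x => if mem Z x then g x else 0) in gZ'.
have f12 x : f x = f1 x + f2 x by rewrite /f1 /f2 /=; case: ifP; rewrite ?add0r ?addr0.
have g12 x : g x = g1 x + g2 x by rewrite /g1 /g2 /=; case: ifP; rewrite ?add0r ?addr0.
exists (Defs.conv g2 (check f2)), (undup [seq gmul y (ginv z) | y <- Z, z <- Y]).
split; [split|].
- exact: undup_uniq.
- move=> x; rewrite mem_undup => xZY; apply: hassumC_unique (hassum_conv hp x fY' gZ') _.
  apply: hassumC_eq (hassumC0 _) => y; rewrite /f2 /g2 /=.
  case: ifPn => [yZ|]; last by rewrite mul0r.
  case: ifPn => [xyY|]; last by rewrite mulr0.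
  case/negP: xZY; apply/allpairsP; exists (y, gmul (ginv x) y); split=> //=.
  by rewrite ginvM ginvK gmulVKr.
have [A1 n1] := Ap_conv hp fA gZ; have [A2 n2] := Ap_conv hp fY gZ'.
have [_] := Ap_add hp A1 A2; rewrite /Apdist.
rewrite (_ : (fun x => _ + _) = (fun x => Defs.conv g (check f) x - Defs.conv g2 (check f2) x)).
  move=> n3; apply: (le_lt_trans n3).
  apply: (le_lt_trans (lerD n1 n2)).
  have : A * eta + eta * B + eta = e / 2 by rewrite -etaE; ring.
  clear -eta0 e0; lra.
apply/funext => x; apply/eqP; rewrite eq_sym subr_eq; apply/eqP.
apply: hassumC_unique (hassum_conv hp x fA gB) _.
apply: hassumC_eq (hassumCD (hassumCD (hassum_conv hp x fA gZ) (hassum_conv hp x fY gZ'))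
  (hassum_conv hp x fY' gZ')) => y.
by rewrite (f12 (gmul _ y)) (g12 y); ring.
Qed.

Lemma Ap_approximable u : Ap p u -> approximable u.
Proof.
move=> uA; apply: approximable_closed; [exact: uA|move=> e e0].
have e20 : 0 < e / 2 by lra.
have [|f [g [a [b S]]]] := @Ap_sum_nat R G p hp u (Apnorm p u + 1) uA; first by rewrite ltrDl.
have [fa gb abr _] := S.
have ab0 n : 0 <= a n * b n by rewrite mulr_ge0 ?(fa n).1 ?(gb n).1.
have [F uF Fe] := sums_le_tail ab0 abr e20.
pose w n := Defs.conv (g n) (check (f n)).
exists (fun x => \sum_(n <- F) w n x).
  by apply: approximable_sum => n; exact: approximable_conv (fa n) (gb n).
apply: (@le_lt_trans _ _ (e / 2)); last by lra.
(* The difference between [u] and its partial sum over [F] is represented by the same series with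
   the terms in [F] set to zero. *)
pose f' n := if n \in F then fun=> 0 else f n; pose a' n := if n \in F then 0 else a n.
have fa' n : lp_le p (f' n) (a' n).
  by rewrite /f' /a'; case: ifP => _; [exact: lp_le0|exact: fa].
have ab' : sums_le (fun n => a' n * b n) (e / 2).
  by apply: sums_leW (lexx _) Fe => n; rewrite /a'; case: ifP; rewrite ?mul0r.
apply: (Ap_sum_Ap hp (Ap_sumI hp (c := fun n x => if n \in F then 0 else w n x) fa' gb ab' _ _)).2.
- move=> n x; rewrite /f'; case: ifP => _; last exact: hassum_conv (fa n) (gb n).
  by apply: hassumC_eq (hassumC0 _) => y; rewrite mulr0.
- move=> x.
  have Fsum := hassumC_fin (h := fun n => if n \in F then w n x else 0) uF.
  have := hassumC_lin (-1) (Fsum _) (Ap_sumE hp x S).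
  rewrite big_seq (eq_bigr (fun n => w n x)) => [|n ->//].
  rewrite -big_seq mulN1r addrC => H; apply: hassumC_eq (H _) => [n|n /negPf -> //].
  by rewrite /w; case: ifP => _; rewrite ?mulr0 ?add0r ?mulN1r ?addNr.
Qed.

End Density.

Section Geometric.
Context {R : realType}.

Lemma sums_le_geometric : sums_le (fun n => 2^-1 ^+ n : R) 2.
Proof.
move=> F uF; set N := (\max_(n <- F) n).+1.
apply: (le_trans (sum_subseq (G := iota 0 N) _ uF (iota_uniq _ _) _)).
- by move=> n; rewrite exprn_ge0// invr_ge0.
- by move=> n nF; rewrite mem_iota add0n ltnS; apply: leq_bigmax_seq.
- rewrite -[X in iota _ X]subn0 -/(index_iota 0 N) big_mkord.
  suff -> : \sum_(i < N) 2^-1 ^+ i = 2 - 2 * 2^-1 ^+ N :> R.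
    by rewrite lerBlDr lerDl mulr_ge0// exprn_ge0// invr_ge0.
  elim: N => [|N IH]; first by rewrite big_ord0 expr0; ring.
  by rewrite big_ord_recr /= IH exprS; field.
Qed.

Lemma geometric_small (c e : R) N : 0 < e -> exists2 n, (N <= n)%N & c * 2^-1 ^+ n < e.
Proof.
move=> e0; pose n := maxn N (Num.bound `|c / e|); exists n; first exact: leq_maxl.
rewrite exprVn ltr_pdivrMr ?exprn_gt0// mulrC -ltr_pdivrMr//.
apply: (@lt_le_trans _ _ (Num.bound `|c / e|)%:R).
  exact: (le_lt_trans (ler_norm _) (archi_boundP (normr_ge0 _))).
by rewrite -natrX ler_nat (leq_trans (leq_maxr N _))// ltnW// ltn_expl.
Qed.

Lemma hassumC_nat (h : nat -> R[i]) s : hassumC h s ->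
  forall e, 0 < e -> exists N, forall n, (N <= n)%N -> cabs (\sum_(i < n) h i - s) < e.
Proof.
move=> hs e /hs[F sF]; exists (\max_(n <- F) n).+1 => n Fn.
rewrite -(big_mkord xpredT h) /index_iota subn0; apply: sF; first exact: iota_uniq.
move=> i iF; rewrite mem_iota add0n /=; apply: leq_ltn_trans Fn.
exact: (leq_bigmax_seq (F := id)).
Qed.

End Geometric.

(** * Multiplication on the pointwise closure of the unit ball *)

Section BallClosure.
Context {R : realType} {G : dgroup}.
Variable p : R.
Hypothesis hp : 1 < p.
Implicit Types (u v w : G -> R[i]) (x y : G).

Definition Ap_ball v := Ap p v /\ Apnorm p v <= 1.

(* The pointwise closure of the unit ball: its elements need not lie in [Ap]. *)
Definition ball_lim v := forall (E : seq G) e, 0 < e ->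
  exists v', Ap_ball v' /\ forall x, x \in E -> cabs (v x - v' x) < e.

Lemma Ap_ball_lim v : Ap_ball v -> ball_lim v.
Proof. by move=> vB E e e0; exists v; split=> // x _; rewrite subrr cabs0. Qed.

Lemma ball_lim_le1 v x : ball_lim v -> cabs (v x) <= 1.
Proof.
move=> vL; apply/ler_addgt0Pr => e e0.
have [v' [[v'A v'1] H]] := vL [:: x] _ e0; have := H x; rewrite inE eqxx => /(_ isT).
have := cabs_le_Apnorm hp x v'A; have := cabs_distD (v' x) (v x) 0; rewrite !subr0.
move: v'1; clear; lra.
Qed.

Lemma finsupp_mul_small (E : seq G) u v d : supported_in E u ->
  (forall x, x \in E -> cabs (v x) <= d) ->
  Ap p (pmul u v) /\ Apnorm p (pmul u v) <= (\sum_(x <- E) cabs (u x)) * d.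
Proof.
move=> [uE u0] vd; have [|A n] := @Ap_finsupp R G p hp E (pmul u v) uE.
  by move=> x /u0; rewrite /pmul => ->; rewrite mul0r.
split; first exact: A.
apply: (le_trans n); rewrite mulr_suml big_seq [leRHS]big_seq.
by apply: ler_sum => x xE; rewrite cabsM ler_wpM2l ?cabs_ge0 ?vd.
Qed.

Lemma scaled_margin (S e : R) : 0 <= S -> 0 < e -> exists2 d, 0 < d & S * d <= e.
Proof.
move=> S0 e0; exists (e / (S + 1)); first by rewrite divr_gt0//; lra.
by rewrite mulrCA ler_piMr ?(ltW e0)// ler_pdivrMr ?mul1r; lra.
Qed.

(** On [E] the limit [v] is within [d] of some [v'] in the ball: [u v'] is handled by
    submultiplicativity, and [u (v - v')] costs at most [d] times the sum of the moduli of [u]. *)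
Lemma finsupp_mul_lim (E : seq G) u v : supported_in E u -> ball_lim v ->
  Ap p (pmul u v) /\ Apnorm p (pmul u v) <= Apnorm p u.
Proof.
move=> uE vL; have uA := supported_Ap hp uE.
have [A _] := finsupp_mul_small uE (fun x _ => ball_lim_le1 x vL).
split; first exact: A.
apply/ler_addgt0Pr => e e0.
have S0 : 0 <= \sum_(x <- E) cabs (u x) by rewrite sumr_ge0// => x _; exact: cabs_ge0.
have [d d0 Sd] := scaled_margin S0 e0.
have [v' [[v'A v'1] H]] := vL E _ d0.
have [B nB] := finsupp_mul_small (v := fun x => v x - v' x) uE (fun x xE => ltW (H x xE)).
have [C nC] := Ap_mul hp uA v'A; have [_] := Ap_add hp C B.
rewrite (_ : (fun x => _ + _) = pmul u v); last by apply/funext => x; rewrite /pmul; ring.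
move=> n3; apply: (le_trans n3); apply: lerD; last exact: le_trans nB Sd.
by apply: (le_trans nC); rewrite ler_piMr// Apnorm_ge0.
Qed.

(* [u] is the sum of a series of finitely supported functions [d n] whose norms add up
   to about [Apnorm p u]; multiplying each of them by [v] does not increase its norm. *)
Lemma Ap_mul_lim u v : Ap p u -> ball_lim v ->
  Ap p (pmul u v) /\ Apnorm p (pmul u v) <= Apnorm p u.
Proof.
move=> uA vL.
have H e : 0 < e -> Ap p (pmul u v) /\ Apnorm p (pmul u v) <= Apnorm p u + e * 8.
  move=> e0; have [del del0 delE] : exists2 del : nat -> R, forall n, 0 < del n &
      forall n, del n = e * 2^-1 ^+ n.
    by exists (fun n => e * 2^-1 ^+ n) => // n; rewrite mulr_gt0// exprn_gt0// invr_gt0.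
  have delS n : del n = 2 * del n.+1 by rewrite !delE exprS; field.
  have /choice[w /choice[E /all_and2[wE wu]]] := fun n => (Ap_approximable hp uA).2 _ (del0 n).
  have wA n := supported_Ap hp (wE n).
  pose d n := if n is m.+1 then fun x => w m.+1 x - w m x else w 0%N.
  (* Passing through [u], the norm of [d n.+1] is below [del n.+1 + del n = 3 * del n.+1], so [4]
     suffices; the geometric series then adds up to [e * 8]. *)
  pose r n := (if n == 0%N then Apnorm p u else 0) + 4 * del n.
  have dE n : supported_in (undup (E n ++ E n.-1)) (d n).
    split=> [|x]; first exact: undup_uniq.
    rewrite mem_undup mem_cat negb_or => /andP[xn xm].
    case: n xn xm => [|n] /= xn xm; first exact: (wE 0%N).2.
    by rewrite (wE n.+1).2// (wE n).2// subrr.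
  have dr n : Apnorm p (d n) < r n.
    have uw m : Apdist p (w m) u < del m by rewrite (ApdistC hp (wA m) uA).
    rewrite /r; case: n => [|n] /=.
      apply: (le_lt_trans (Apnorm_le_dist hp (wA 0%N) uA)).
      by rewrite ltrD2l (lt_le_trans (uw 0%N))// ler_peMl// ?ler1n// ltW.
    apply: (le_lt_trans (Apdist_trans hp (wA n.+1) uA (wA n))).
    move: (uw n.+1) (wu n) (del0 n.+1); rewrite (delS n); clear; lra.
  have rM : sums_le r (Apnorm p u + e * 8).
    apply: sums_leD; last first.
      have e4 : 0 <= e * 4 by rewrite mulr_ge0 ?ltW.
      rewrite (_ : e * 8 = e * 4 * 2); last by ring.
      apply: sums_leW (lexx _) (sums_leZ e4 (@sums_le_geometric R)) => n.
      by rewrite delE mulrCA mulrA.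
    move=> F uF; apply: (le_trans (sum_subseq (G := undup (0%N :: F)) _ uF (undup_uniq _) _)).
    - by case=> [|n] //=; exact: Apnorm_ge0.
    - by move=> n nF; rewrite mem_undup inE nF orbT.
    - rewrite -big_mkcond -big_filter filter_pred1_uniq ?undup_uniq ?big_seq1//.
      by rewrite mem_undup inE eqxx.
  have dvA n : Ap p (pmul (d n) v) by have [] := finsupp_mul_lim (dE n) vL.
  have dvr n : Apnorm p (pmul (d n) v) < r n.
    exact: le_lt_trans (finsupp_mul_lim (dE n) vL).2 (dr n).
  apply: (Ap_countable_sum hp dvA dvr rM) => x.
  have dvx n : cabs (pmul (d n) v x) <= r n.
    exact: le_trans (cabs_le_Apnorm hp x (dvA n)) (ltW (dvr n)).
  have [s hs] := hassumC_abs (sums_leW dvx (lexx _) rM).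
  suff -> : pmul u v x = s by exact: hs.
  apply/eqP; rewrite -subr_eq0; apply/eqP; apply: cabs_small => eps eps0.
  have eps20 : 0 < eps / 2 by lra.
  have [N hN] := hassumC_nat hs eps20.
  have [n Nn nsmall] := geometric_small e N eps20.
  (* The differences telescope, and [w n] tends to [u] pointwise; this identifies the sum of the
     series. *)
  have sumE : \sum_(i < n.+1) pmul (d i) v x = w n x * v x.
    elim: n {Nn nsmall} => [|n IH]; first by rewrite big_ord1.
    by rewrite big_ord_recr /= IH /pmul /=; ring.
  have := hN n.+1 (leqW Nn); rewrite sumE => close.
  apply: (le_lt_trans (cabs_distD (w n x * v x) _ _)).
  have : cabs (pmul u v x - w n x * v x) <= del n.
    rewrite /pmul -mulrBl cabsM -[leRHS]mulr1.
    apply: ler_pM; [exact: cabs_ge0|exact: cabs_ge0| |exact: ball_lim_le1].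
    exact: le_trans (cabs_le_Apnorm hp x (Ap_sub hp uA (wA n)).1) (ltW (wu n)).
  rewrite delE; move: close nsmall; clear; lra.
split; first by case: (H 1).
apply/ler_addgt0Pr => e e0; have [|_] := H (e / 8); first by rewrite divr_gt0.
by rewrite divfK.
Qed.

(** Write [u v - u v'] as [(u - u1) v - (u - u1) v' + u1 (v - v')]. By [Ap_mul_lim] the first two
    terms are small uniformly in [v] and [v']; only the last depends on their values on [E]. *)
Lemma Ap_mul_lim_close u e : Ap p u -> 0 < e -> exists (E : seq G) d, 0 < d /\
  forall v v', ball_lim v -> ball_lim v' -> (forall x, x \in E -> cabs (v x - v' x) < d) ->
  Apdist p (pmul u v) (pmul u v') < e.
Proof.
move=> uA e0; have e40 : 0 < e / 4 by lra.
have [u1 [E [u1E du]]] := (Ap_approximable hp uA).2 _ e40.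
have u1A := supported_Ap hp u1E.
have S0 : 0 <= \sum_(x <- E) cabs (u1 x) by rewrite sumr_ge0// => x _; exact: cabs_ge0.
have [d d0 Sd] := scaled_margin S0 e40.
exists E, d; split=> [//|v v' vL v'L vv'].
have uu1A := (Ap_sub hp uA u1A).1.
have [A1 n1] := Ap_mul_lim uu1A vL; have [A2 n2] := Ap_mul_lim uu1A v'L.
have [A3 n3] := finsupp_mul_small (v := fun x => v x - v' x) u1E (fun x xE => ltW (vv' x xE)).
have [A4 n4] := Ap_sub hp A1 A2; have [_ n5] := Ap_add hp A4 A3.
rewrite /Apdist (_ : (fun x => _) = (fun x => pmul (fun x => u x - u1 x) v x -
    pmul (fun x => u x - u1 x) v' x + pmul u1 (fun x => v x - v' x) x)).
  rewrite /Apdist in du; apply: (le_lt_trans n5).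
  move: n1 n2 n3 n4 Sd du e0; clear; lra.
by apply/funext => x; rewrite /pmul; ring.
Qed.

End BallClosure.

(** * Pointwise limits along ultrafilters *)

Section UltraLimits.
Import numFieldNormedType.Exports.
Context {R : realType}.
Local Open Scope classical_set_scope.
Local Open Scope complex_scope.

(** Compactness of [[-1, 1]] gives a cluster point, and for an ultrafilter a cluster point is a
    limit. *)
Lemma ultra_lim_real (X : Type) (U : set_system X) (f : X -> R) : UltraFilter U ->
  U [set w | `|f w| <= 1] -> exists l : R, forall e : R, 0 < e -> U [set w | `|f w - l| < e].
Proof.
move=> UU Uf.
have fU : U (f @^-1` `[-1, 1]).
  by apply: filterS Uf => w /=; rewrite in_itv /= ler_norml.
have [l [_ cl]] := @segment_compact R (-1) 1 (f @ U) (fmap_proper_filter f _) fU.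
exists (l : R) => e e0.
have [//|nU] := in_ultra_setVsetC [set w | `|f w - l| < e] UU.
have [r [/= far near_r]] := cl (~` [set r | `|r - l| < e]) _ nU (nbhsx_ballx (l : R) e e0).
by case: far; rewrite distrC.
Qed.

Lemma ultra_lim (X : Type) (U : set_system X) (f : X -> R[i]) : UltraFilter U ->
  U [set w | cabs (f w) <= 1] -> exists l : R[i], forall e : R, 0 < e -> U [set w | cabs (f w - l) < e].
Proof.
move=> UU Uf.
have [|a Ha] := @ultra_lim_real _ U (fun w => complex.Re (f w)) UU.
  by apply: filterS Uf => w /=; apply: le_trans; exact: ler_Re_cabs.
have [|b Hb] := @ultra_lim_real _ U (fun w => complex.Im (f w)) UU.
  by apply: filterS Uf => w /=; apply: le_trans; exact: ler_Im_cabs.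
exists (a +i* b) => e e0; have e20 : 0 < e / 2 by lra.
apply: filterS (filterI (Ha _ e20) (Hb _ e20)) => w [/= A B].
apply: (le_lt_trans (cabs_le_ReIm _)); case: (f w) A B => c d /=; lra.
Qed.

(** Does the work of Tychonoff's theorem for a product of unit discs. *)
Lemma ultra_lim_fun (X : Type) (U : set_system X) (T : choiceType) (f : X -> T -> R[i]) :
  UltraFilter U -> U [set w | forall x, cabs (f w x) <= 1] ->
  exists l : T -> R[i], forall (E : seq T) (e : R), 0 < e ->
    U [set w | forall x, x \in E -> cabs (f w x - l x) < e].
Proof.
move=> UU Uf; have /choice[l Hl] x : exists l, forall e, 0 < e -> U [set w | cabs (f w x - l) < e].
  by apply: ultra_lim; apply: filterS Uf => w /=.
exists l => E e e0; elim: E => [|x E IH]; first by apply: filterS filterT => w.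
apply: filterS (filterI (Hl x _ e0) IH) => w [/= A B] y.
by rewrite inE => /predU1P[->//|]; exact: B.
Qed.

End UltraLimits.

(** * Weak topology and weakly compact multipliers *)

Section WeakCompactness.
Context {R : realType} {G : dgroup}.
Variable p : R.
Hypothesis hp : 1 < p.
Implicit Types (u v w a : G -> R[i]) (x y : G).
Local Open Scope classical_set_scope.

Lemma bdd_functional_eval x : bdd_functional p (fun u : G -> R[i] => u x).
Proof.
split; first by [].
by exists 1 => u uA; rewrite mul1r; exact: cabs_le_Apnorm.
Qed.

Lemma weak_nbhs_eval a (E : seq G) e : 0 < e ->
  weak_nbhs p a [set w | forall x, x \in E -> cabs (w x - a x) < e].
Proof.
move=> e0; exists (size E), (fun k u => u (tnth (in_tuple E) k)), e; split=> //.
  by move=> k; exact: bdd_functional_eval.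
move=> w _ H x /(tnthP (in_tuple E))[k ->]; exact: H.
Qed.

Lemma weak_nbhs_norm a N : Ap p a -> weak_nbhs p a N ->
  exists2 d, 0 < d & forall w, Ap p w -> Apdist p w a < d -> N w.
Proof.
move=> aA [n [phi [e [e0 phiB phiN]]]].
have /choice[M HM] : forall k, exists M : R, forall u, Ap p u -> cabs (phi k u) <= M * Apnorm p u.
  by move=> k; have [_] := phiB k.
have S0 : 0 <= \sum_k `|M k| by rewrite sumr_ge0.
have e20 : 0 < e / 2 by lra.
have [d d0 Sd] := scaled_margin S0 e20.
exists d => // w wA dwa; apply: phiN => // k.
have [lin _] := phiB k.
have -> : phi k w - phi k a = phi k (fun x => w x - a x).
  rewrite (_ : (fun x => _) = (fun x => -1 * a x + w x)).
    by rewrite lin// mulN1r addrC.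
  by apply/funext => x; rewrite mulN1r addrC.
apply: (le_lt_trans (HM k _ (Ap_sub hp wA aA).1)).
apply: (@le_lt_trans _ _ (e / 2)); last by move: e0; lra.
apply: le_trans Sd; apply: (@le_trans _ _ (`|M k| * Apdist p w a)).
  by apply: ler_wpM2r; [exact: Apnorm_ge0|exact: ler_norm].
apply: ler_pM => //; [exact: Apnorm_ge0| |exact: ltW].
by rewrite (bigD1 k)//= lerDl sumr_ge0.
Qed.

(* The trace on the unit ball of the filter of functions [v] such that [u v] tends to [a]
   pointwise. *)
Definition ball_filter u a : set_system (G -> R[i]) :=
  [set B | exists (E : seq G) e, 0 < e /\
     forall v, Ap_ball p v -> (forall x, x \in E -> cabs (u x * v x - a x) < e) -> B v].

Lemma ball_filter_proper u a :
  (forall (E : seq G) e, 0 < e ->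
     exists v, Ap_ball p v /\ forall x, x \in E -> cabs (u x * v x - a x) < e) ->
  ProperFilter (ball_filter u a).
Proof.
move=> H; apply: Build_ProperFilter_ex => [B [E [e [e0 EB]]]|].
  by have [v [vB vE]] := H E e e0; exists v; exact: EB.
split=> [|A B [E [e [e0 EA]]] [E' [e' [e'0 EB]]]|A B AB [E [e [e0 EA]]]].
- by exists [::], 1.
- exists (E ++ E'), (Num.min e e'); split=> [|v vB vE]; first by rewrite lt_min e0.
  split; [apply: EA|apply: EB] => // x xE.
    by apply: lt_le_trans (vE x _) _; rewrite ?mem_cat ?xE// ge_min lexx.
  by apply: lt_le_trans (vE x _) _; rewrite ?mem_cat ?xE ?orbT// ge_min lexx orbT.
- by exists E, e; split=> // v vB vE; apply/AB/EA.
Qed.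

Lemma ball_filter_ball u a : ball_filter u a [set v | Ap_ball p v].
Proof. by exists [::], 1; split=> // v. Qed.

Lemma ball_filter_near u a (E : seq G) e : 0 < e ->
  ball_filter u a [set v | forall x, x \in E -> cabs (u x * v x - a x) < e].
Proof. by move=> e0; exists E, e. Qed.

Local Notation image_ball u :=
  [set w | exists v, [/\ Ap p v, Apnorm p v <= 1 & w = pmul u v]].

(** Weak neighbourhoods control finitely many point values, so the filter of those [v] with [u v]
    near [w] is proper. The pointwise limit of the ball elements along a finer ultrafilter is the
    required [v]. *)
Lemma weak_closure_image_ball u w :
  weak_closure p (image_ball u) w -> exists2 v, ball_lim p v & w = pmul u v.
Proof.
move=> [wA wN].
have /ball_filter_proper PF : forall (E : seq G) e, 0 < e ->
    exists v, Ap_ball p v /\ forall x, x \in E -> cabs (u x * v x - w x) < e.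
  move=> E e e0; have [_ [[v [vA v1 ->]] near_w]] := wN _ (weak_nbhs_eval w E e0).
  by exists v.
have [U [UU sU]] := ultraFilterLemma PF.
have [|l Hl] := @ultra_lim_fun R _ U G id UU.
  apply: filterS (sU _ (ball_filter_ball u w)) => v /= vB x.
  exact (ball_lim_le1 hp x (Ap_ball_lim vB)).
exists l => [E e e0|].
  have [v [/= vl vB]] := filter_ex (filterI (Hl E e e0) (sU _ (ball_filter_ball u w))).
  by exists v; split=> // x /vl; rewrite cabs_distC.
apply/funext => x; apply/eqP; rewrite -subr_eq0; apply/eqP; apply: cabs_small => e e0.
have e20 : 0 < e / 2 by lra.
have [d d0 ud] := scaled_margin (cabs_ge0 (u x)) e20.
have [v [/= vl vw]] :=
  filter_ex (filterI (Hl [:: x] d d0) (sU _ (ball_filter_near u w [:: x] e20))).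
have xx : x \in [:: x] by rewrite inE.
apply: (le_lt_trans (cabs_distD (u x * v x) _ _)); rewrite cabs_distC.
have : cabs (u x * v x - pmul u l x) <= e / 2.
  rewrite /pmul -mulrBr cabsM; apply: le_trans ud.
  by apply: ler_wpM2l; [exact: cabs_ge0|exact/ltW/vl].
move: (vw x xx); lra.
Qed.

Lemma Ap_Gamma_weakly_compact u : Ap p u -> Gamma_weakly_compact p u.
Proof.
move=> uA; split; first by move=> w [].
move=> F FF FW; have [U [UU sU]] := ultraFilterLemma FF.
(* [s] divides by [u] on the weak closure. The quotients [s w] are bounded by [1], so they have a
   pointwise limit [l], and [u l] will be the cluster point. *)
have /choice[s Hs] : forall w, exists v, weak_closure p (image_ball u) w ->
    ball_lim p v /\ w = pmul u v.
  move=> w; have [/weak_closure_image_ball[v vL wE]|nW] := pselect (weak_closure p (image_ball u) w).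
    by exists v.
  by exists (fun=> 0).
have [|l Hl] := @ultra_lim_fun R _ U G s UU.
  apply: filterS (sU _ FW) => w /= /Hs[vL _] x.
  exact (ball_lim_le1 hp x vL).
have lL : ball_lim p l.
  move=> E e e0; have e20 : 0 < e / 2 by lra.
  have [w [/= wl /Hs[wL _]]] := filter_ex (filterI (Hl E _ e20) (sU _ FW)).
  have [v [vB vw]] := wL E _ e20; exists v; split=> // x xE.
  apply: (le_lt_trans (cabs_distD (s w x) _ _)); rewrite cabs_distC.
  by move: (wl x xE) (vw x xE); lra.
have aA := (Ap_mul_lim hp uA lL).1.
exists (pmul u l); split.
  (* The cluster point must itself lie in the weak closure: a ball element [v] near [l] on [E]
     brings [u v] near [u l] in norm. *)
  split=> // N /(weak_nbhs_norm aA)[d d0 dN].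
  have [E [e [e0 close]]] := Ap_mul_lim_close hp uA d0.
  have [v [vB vl]] := lL E e e0.
  exists (pmul u v); split; first by exists v; split=> //; case: vB.
  apply: dN; first by have [] := Ap_mul hp uA vB.1.
  apply: close => // [|x /vl]; [exact: Ap_ball_lim|by rewrite cabs_distC].
move=> B N FB /(weak_nbhs_norm aA)[d d0 dN].
have [E [e [e0 close]]] := Ap_mul_lim_close hp uA d0.
have [w [[/= Bw Ww] wl]] :=
  filter_ex (filterI (filterI (sU _ FB) (sU _ FW)) (Hl E e e0)).
have [sL wE] := Hs _ Ww; have wA := Ww.1.
exists w; split=> //; apply: dN => //.
by rewrite [X in Apdist p X _]wE; exact: close.
Qed.

Lemma Ap_Bp u : Ap p u -> Bp p u.
Proof.
move=> uA; split; last by move=> v vA; have [] := Ap_mul hp uA vA.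
by exists (Apnorm p u) => x; exact: cabs_le_Apnorm.
Qed.

(* Weak compactness catches a weak, hence pointwise, cluster point of [u v] as [v] runs
   through the bounded approximate identity; it has to be [u]. *)
Lemma WCBp_Ap u :
  (forall (E : seq G) e, 0 < e ->
     exists v, Ap_ball p v /\ forall x, x \in E -> cabs (v x - 1) < e) ->
  WCBp p u -> Ap p u.
Proof.
move=> approx_id [[_ uB] [Wsub Wc]].
(* With both parameters equal to [1], [ball_filter] describes ball elements tending pointwise to
   [1]; hence the factor [1]. *)
have /ball_filter_proper PF : forall (E : seq G) e, 0 < e ->
    exists v, Ap_ball p v /\ forall x, x \in E -> cabs (1 * v x - 1) < e.
  move=> E e /(approx_id E)[v [vB vE]]; exists v; split=> // x /vE.
  by rewrite mul1r.
have [|a [[aA _] cl]] := Wc (pmul u @ ball_filter (fun=> 1) (fun=> 1)) (fmap_proper_filter _ PF).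
  apply: filterS (ball_filter_ball _ _) => v [vA v1]; split; first exact: uB.
  move=> N [n [phi [e [e0 _ phiN]]]]; exists (pmul u v); split; first by exists v.
  by apply: phiN => [|k]; [exact: uB|rewrite subrr cabs0].
suff -> : u = a by [].
apply/funext => x; apply/eqP; rewrite -subr_eq0; apply/eqP; apply: cabs_small => e e0.
have e20 : 0 < e / 2 by lra.
have [d d0 ud] := scaled_margin (cabs_ge0 (u x)) e20.
have xx : x \in [:: x] by rewrite inE.
(* A point common to [B] and the weak neighbourhood is some [u v] whose value at [x] is close both
   to [u x] and to [a x]. *)
pose B := pmul u @` [set v | forall y, y \in [:: x] -> cabs (1 * v y - 1) < d].
have FB : (pmul u @ ball_filter (fun=> 1) (fun=> 1)) B.
  by apply: filterS (ball_filter_near (fun=> 1) (fun=> 1) [:: x] d0) => v vd; exists v.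
have [_ [_ [v /(_ x xx) vd <-] va]] := cl B _ FB (weak_nbhs_eval a [:: x] e20).
apply: (le_lt_trans (cabs_distD (pmul u v x) _ _)).
have : cabs (u x - pmul u v x) <= e / 2.
  rewrite /pmul -[X in X - _]mulr1 -mulrBr cabsM; apply: le_trans ud.
  by apply: ler_wpM2l; [exact: cabs_ge0|rewrite cabs_distC -[v x]mul1r ltW].
by move: (va x xx); lra.
Qed.

End WeakCompactness.

(** * Additive minorants of sublinear functionals *)

Section HahnBanach.
Context {R : realType}.
Variables (V : lmodType R) (D : set V).
Hypothesis D_add : forall f g, D f -> D g -> D (f + g).
Hypothesis D_scale : forall (c : R) f, D f -> D (c *: f).
Local Open Scope classical_set_scope.

(** Restricted to [D] so that [V] can be the space of all functions and [D] the summable ones,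
    without a subtype. The inequality for scalars becomes an equality on applying it to [c^-1]. *)
Definition sublinear_on (q : V -> R) :=
  (forall f g, D f -> D g -> q (f + g) <= q f + q g) /\
  (forall (c : R) f, 0 < c -> D f -> q (c *: f) <= c * q f).

Lemma sublinear_onZ q c f : sublinear_on q -> 0 < c -> D f -> q (c *: f) = c * q f.
Proof.
move=> [_ qZ] c0 Df; apply/eqP; rewrite eq_le qZ//=.
have ci0 : 0 < c^-1 by rewrite invr_gt0.
have := qZ _ _ ci0 (D_scale c Df); rewrite scalerA mulVf ?gt_eqF// scale1r.
by rewrite mulrC ler_pdivlMr// mulrC.
Qed.

Lemma sublinear_on_lower q f : sublinear_on q -> D f -> - q (- f) <= q f.
Proof.
move=> qS Df; have DN : D (- f) by rewrite -scaleN1r; exact: D_scale.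
have D0 : D 0 by rewrite -(addNr f); exact: D_add.
have q0 : q 0 = 0.
  have := sublinear_onZ qS (ltr0Sn R 1) D0; rewrite scaler0; lra.
have := qS.1 _ _ Df DN; rewrite subrr q0; lra.
Qed.

(* A functional that is minimal among the sublinear ones is additive: for [h] in [D],
   [k |-> inf_t (q (k + t h) - t q h)] is again sublinear and lies below [q]. *)
Lemma sublinear_minorant P : sublinear_on P ->
  exists L : V -> R, (forall f g, D f -> D g -> L (f + g) = L f + L g) /\
    forall f, D f -> L f <= P f.
Proof.
move=> PS.
pose S := {q : V -> R | sublinear_on q /\ forall f, D f -> q f <= P f}.
(* The order is reversed, so the maximal element from Zorn's lemma is a minimal functional. *)
pose r (q1 q2 : S) := `[< forall f, D f -> sval q2 f <= sval q1 f >].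
pose P' : S := exist _ P (conj PS (fun f _ => lexx _)).
have DN f : D f -> D (- f) by rewrite -scaleN1r; exact: D_scale.
have [[] | | |[q [qS qP]] qmin] := @ZL_preorder S P' r.
- by move=> q qS; apply/asboolP.
- move=> q1 q2 q3 /asboolP r12 /asboolP r23; apply/asboolP => f Df.
  exact: le_trans (r23 f Df) (r12 f Df).
- move=> A Atot; have [[q0 Aq0]|nA] := pselect (A !=set0); last first.
    by exists P' => s As; case: nA; exists s.
  pose B f := [set sval q f | q in A]; pose m f := inf (B f).
  have Blb f : D f -> has_lbound (B f).
    move=> Df; exists (- P (- f)) => _ [q Aq <-]; have [qS qP] := svalP q.
    by apply: le_trans (sublinear_on_lower qS Df); rewrite lerN2; apply/qP/DN.
  have B0 f : B f !=set0 by exists (sval q0 f), q0.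
  have mle q f : A q -> D f -> m f <= sval q f.
    by move=> Aq Df; apply: ge_inf; [exact: Blb|exists q].
  have mS : sublinear_on m.
    split=> [f g Df Dg|c f c0 Df].
      apply/ler_addgt0Pr => e e0; have e20 : 0 < e / 2 by lra.
      have [|_ [q1 Aq1 <-] q1f] := @inf_lt _ (B f) (m f + e / 2) (B0 f); first by rewrite ltrDl.
      have [|_ [q2 Aq2 <-] q2g] := @inf_lt _ (B g) (m g + e / 2) (B0 g); first by rewrite ltrDl.
      (* Members of a chain are comparable; the smaller of [q1] and [q2] is near the infimum at both
         [f] and [g]. *)
      have [q [Aq qf qg]] : exists q, [/\ A q, sval q f <= sval q1 f & sval q g <= sval q2 g].
        have [/asboolP H|/asboolP H] := Atot _ _ Aq1 Aq2.
          by exists q2; split=> //; exact: H.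
        by exists q1; split=> //; exact: H.
      have [qS qP] := svalP q; have := mle q _ Aq (D_add Df Dg); have := qS.1 _ _ Df Dg.
      move: q1f q2g qf qg; lra.
    rewrite -ler_pdivrMl//; apply: lb_le_inf; first exact: B0.
    move=> _ [q Aq <-]; have [qS qP] := svalP q.
    rewrite ler_pdivrMl//; apply: le_trans (mle q _ Aq (D_scale c Df)) _; exact: qS.2.
  have mP f : D f -> m f <= P f.
    by move=> Df; apply: le_trans (mle q0 _ Aq0 Df) _; have [_] := svalP q0; apply.
  exists (exist _ m (conj mS mP)) => q Aq; apply/asboolP => f Df /=; exact: mle.
exists q; split=> // h k Dh Dk.
apply/eqP; rewrite eq_le qS.1//= (addrC h).
pose B k := [set q (k + t *: h) - t * q h | t in [set t | 0 <= t]]; pose m k := inf (B k).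
have Dkt t k' : D k' -> D (k' + t *: h) by move=> Dk'; exact/D_add/D_scale.
have q0 : q 0 = 0.
  have D0 : D 0 by rewrite -(addNr h); apply: D_add => //; exact: DN.
  have := sublinear_onZ qS (ltr0Sn R 1) D0; rewrite scaler0; lra.
have Blb k' : D k' -> has_lbound (B k').
  move=> Dk'; exists (- q (- k')) => _ [t /= t0 <-].
  (* Subadditivity for [t h = (k' + t h) - k'] bounds the infimum from below. *)
  have : t * q h <= q (k' + t *: h) + q (- k').
    rewrite le_eqVlt in t0; case/predU1P: t0 => [<-|t0].
      by rewrite mul0r scale0r addr0; have := sublinear_on_lower qS Dk'; lra.
    rewrite -sublinear_onZ//; have := qS.1 _ _ (Dkt t k' Dk') (DN k' Dk').
    by rewrite addrAC subrr add0r.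
  lra.
have B0 k' : B k' !=set0.
  by exists (q (k' + 0 *: h) - 0 * q h); exists 0 => //=.
have mle t k' : 0 <= t -> D k' -> m k' <= q (k' + t *: h) - t * q h.
  by move=> t0 Dk'; apply: ge_inf; [exact: Blb|exists t].
have mS : sublinear_on m.
  split=> [f g Df Dg|c f c0 Df].
    apply/ler_addgt0Pr => e e0; have e20 : 0 < e / 2 by lra.
    have [|_ [s /= s0 <-] sf] := @inf_lt _ (B f) (m f + e / 2) (B0 f); first by rewrite ltrDl.
    have [|_ [t /= t0 <-] tg] := @inf_lt _ (B g) (m g + e / 2) (B0 g); first by rewrite ltrDl.
    have := mle (s + t) _ (addr_ge0 s0 t0) (D_add Df Dg); rewrite scalerDl addrACA.
    have := qS.1 _ _ (Dkt s f Df) (Dkt t g Dg); move: sf tg; lra.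
  rewrite -ler_pdivrMl//; apply: lb_le_inf; first exact: B0.
  move=> _ [t /= t0 <-]; rewrite ler_pdivrMl//.
  apply: le_trans (mle (c * t) _ (mulr_ge0 (ltW c0) t0) (D_scale c Df)) _.
  rewrite -scalerA -scalerDr mulrBr mulrA lerD2r; apply: qS.2 => //; exact: Dkt.
have mq f : D f -> m f <= q f.
  by move=> Df; have := mle 0 f (lexx _) Df; rewrite scale0r addr0 mul0r subr0.
have mP f : D f -> m f <= P f by move=> Df; exact: le_trans (mq f Df) (qP f Df).
have /asboolP/= qm : r (exist _ m (conj mS mP)) (exist _ q (conj qS qP)).
  by apply: qmin; apply/asboolP => f Df /=; exact: mq.
(* Minimality gives [q <= m]; taking [t = 1] yields [q k <= q (k + h) - q h], the reverse of
   subadditivity. *)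
have := le_trans (qm k Dk) (mle 1 k ler01 Dk); rewrite scale1r mul1r; lra.
Qed.

End HahnBanach.

(** * From an invariant mean to Reiter's condition *)

Section Reiter.
Context {R : realType} {G : dgroup}.
Local Open Scope classical_set_scope.

Lemma sublinear_minorant_fun (T : Type) (D : set (T -> R)) (P : (T -> R) -> R) :
  (forall f g, D f -> D g -> D (fun z => f z + g z)) ->
  (forall (c : R) f, D f -> D (fun z => c * f z)) ->
  (forall f g, D f -> D g -> P (fun z => f z + g z) <= P f + P g) ->
  (forall (c : R) f, 0 < c -> D f -> P (fun z => c * f z) <= c * P f) ->
  exists L : (T -> R) -> R,
    (forall f g, D f -> D g -> L (fun z => f z + g z) = L f + L g) /\
    forall f, D f -> L f <= P f.
Proof.
by move=> D_add D_scale P_add P_scale;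
  exact: (@sublinear_minorant R (T -> R^o) D D_add D_scale P (conj P_add P_scale)).
Qed.

Lemma sums_le_finType (I : finType) (a : I -> R) :
  (forall i, 0 <= a i) -> sums_le a (\sum_(i <- enum I) a i).
Proof.
by move=> a0 F uF; apply: sum_subseq => //; [exact: enum_uniq|move=> i; rewrite mem_enum].
Qed.

Definition summable_fun (T : choiceType) (h : T -> R) := exists M, sums_le (fun t => `|h t|) M.

Definition l1 (T : choiceType) (h : T -> R) := mass (fun t => `|h t|).

Lemma summable_add (T : choiceType) (h k : T -> R) :
  summable_fun h -> summable_fun k -> summable_fun (fun t => h t + k t).
Proof.
move=> [M hM] [N kN]; exists (M + N).
by apply: sums_leW (lexx _) (sums_leD hM kN) => t; exact: ler_normD.
Qed.

Lemma summable_scale (T : choiceType) (c : R) (h : T -> R) :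
  summable_fun h -> summable_fun (fun t => c * h t).
Proof.
move=> [M hM]; exists (`|c| * M).
by apply: sums_leW (lexx _) (sums_leZ (normr_ge0 c) hM) => t; rewrite normrM.
Qed.

Lemma l1_sums_le (T : choiceType) (h : T -> R) :
  summable_fun h -> sums_le (fun t => `|h t|) (l1 h).
Proof. by move=> [M hM]; apply: sums_le_mass hM => t. Qed.

Lemma l1_le (T : choiceType) (h : T -> R) M : sums_le (fun t => `|h t|) M -> l1 h <= M.
Proof. by move=> hM; apply: mass_le hM => t. Qed.

Lemma l1D (T : choiceType) (h k : T -> R) : summable_fun h -> summable_fun k ->
  l1 (fun t => h t + k t) <= l1 h + l1 k.
Proof.
move=> /l1_sums_le hM /l1_sums_le kN; apply: l1_le.
by apply: sums_leW (lexx _) (sums_leD hM kN) => t; exact: ler_normD.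
Qed.

Lemma l1Z (T : choiceType) (c : R) (h : T -> R) : summable_fun h ->
  l1 (fun t => c * h t) <= `|c| * l1 h.
Proof.
move=> /l1_sums_le hM; apply: l1_le.
by apply: sums_leW (lexx _) (sums_leZ (normr_ge0 c) hM) => t; rewrite normrM.
Qed.

(** No normalization: these functions form a cone, which is what makes the functional [P] in
    [reiter] sublinear. *)
Definition density (nu : G -> R) := (forall y, 0 <= nu y) /\ exists M, sums_le nu M.

Lemma densityD nu nu' : density nu -> density nu' -> density (fun y => nu y + nu' y).
Proof.
move=> [nu0 [M nuM]] [nu'0 [N nu'N]]; split=> [y|]; first by rewrite addr_ge0.
by exists (M + N); exact: sums_leD.
Qed.

Lemma densityZ c nu : 0 <= c -> density nu -> density (fun y => c * nu y).
Proof.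
move=> c0 [nu0 [M nuM]]; split=> [y|]; first by rewrite mulr_ge0.
by exists (c * M); exact: sums_leZ.
Qed.

(** All translates are compared with [nu] in a single function, so one [l1] norm controls them
    simultaneously. *)
Definition displacement n (xs : 'I_n -> G) (nu : G -> R) (z : 'I_n * G) : R :=
  nu (gmul (ginv (xs z.1)) z.2) - nu z.2.

Lemma displacement_summable n (xs : 'I_n -> G) nu : density nu ->
  summable_fun (displacement xs nu).
Proof.
move=> [nu0 [M nuM]]; have M0 := sums_le_ge0 nuM.
have MM : forall k : 'I_n, 0 <= M + M by move=> _; rewrite addr_ge0.
exists (\sum_(k <- enum 'I_n) (M + M)).
apply: (sums_le_prod _ _ (sums_le_finType MM)) => [z|k]; first exact: normr_ge0.
have shift := sums_le_inj (@gmulI _ (ginv (xs k))) nuM.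
apply: sums_leW (lexx _) (sums_leD shift nuM) => y.
by rewrite /displacement /= (le_trans (ler_normB _ _))// !ger0_norm.
Qed.

Definition point_mass (T : choiceType) (z w : T) : R := (w == z)%:R.

Lemma point_mass_sums (T : choiceType) (z : T) : sums_le (point_mass z) 1.
Proof.
move=> F uF; rewrite /point_mass -natr_sum (eq_bigr (fun w => if w == z then 1 else 0)%N).
  by rewrite -big_mkcond sum1_count count_uniq_mem// -[1]/(1%:R) ler_nat leq_b1.
by move=> w _; case: eqP.
Qed.

Lemma point_mass_summable (T : choiceType) (z : T) :
  sums_le (fun w => `|point_mass z w|) 1.
Proof.
by apply: sums_leW (lexx _) (point_mass_sums z) => w; rewrite ger0_norm// ler0n.
Qed.

Lemma point_mass_density y : density (point_mass y).
Proof. by split; [move=> w; exact: ler0n|exists 1; exact: point_mass_sums]. Qed.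

Lemma displacement_point_mass n (xs : 'I_n -> G) (t : G) (z : 'I_n * G) :
  displacement xs (point_mass t) z =
  \sum_(k <- enum 'I_n) (-1 * point_mass (k, t) z + point_mass (k, gmul (xs k) t) z).
Proof.
case: z => k y; rewrite big_enum /= (bigD1 k)//= big1 ?addr0 => [|k' k'k]; last first.
  by rewrite /point_mass !xpair_eqE eq_sym (negPf k'k) /=; ring.
rewrite /displacement /point_mass /= !xpair_eqE eqxx /= mulN1r addrC.
congr (- _ + (nat_of_bool _)%:R); apply/eqP/eqP => [<-|->]; first by rewrite gmulVKr.
by rewrite gmulKV.
Qed.

(** Invariance makes the mean of each [phi (k, x_k t) - phi (k, t)] vanish, while positivity and
    [m 1 = 1] make the mean of their sum at least [e]. *)
Lemma mean_displacement (m : (G -> R) -> R) n (xs : 'I_n -> G) (phi : 'I_n * G -> R) (M e : R) :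
  (forall (a : R) (f g : G -> R), Defs.bounded_fun f -> Defs.bounded_fun g ->
     m (fun x => a * f x + g x) = a * m f + m g) ->
  (forall f : G -> R, Defs.bounded_fun f -> (forall x, 0 <= f x) -> 0 <= m f) ->
  m (fun _ => 1) = 1 ->
  (forall (y : G) (f : G -> R), Defs.bounded_fun f -> m (fun x => f (gmul (ginv y) x)) = m f) ->
  (forall z, `|phi z| <= M) ->
  (forall t, e <= \sum_(k <- enum 'I_n) (-1 * phi (k, t) + phi (k, gmul (xs k) t))) -> e <= 0.
Proof.
move=> m_lin m_pos m1 m_inv phiM He.
have b1 : Defs.bounded_fun (fun _ : G => 1 : R) by exists 1 => x; rewrite normr1.
have b0 : Defs.bounded_fun (fun _ : G => 0 : R) by exists 0 => x; rewrite normr0.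
have m0 : m (fun=> 0) = 0.
  have := m_lin 1 _ _ b0 b0; rewrite (_ : (fun x : G => _) = (fun=> 0)); last first.
    by apply/funext => x; rewrite mulr0 addr0.
  lra.
pose f k t := -1 * phi (k, t) + phi (k, gmul (xs k) t).
have bphi k : Defs.bounded_fun (fun t => phi (k, t)) by exists M.
have bphix k : Defs.bounded_fun (fun t => phi (k, gmul (xs k) t)) by exists M.
have bf k : Defs.bounded_fun (f k).
  exists (M + M) => t; rewrite (le_trans (ler_normD _ _))// lerD//.
  by rewrite mulN1r normrN.
have mf k : m (f k) = 0.
  rewrite /f m_lin// mulN1r -(m_inv (ginv (xs k)) (fun t => phi (k, t)))//.
  by rewrite ginvK addNr.
have bmF (s : seq 'I_n) : Defs.bounded_fun (fun t => \sum_(k <- s) f k t) /\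
    m (fun t => \sum_(k <- s) f k t) = 0.
  elim: s => [|k s [[N bs] ms]].
    have z : (fun t => \sum_(k <- [::]) f k t) = (fun=> 0).
      by apply/funext => t; rewrite big_nil.
    by rewrite z; split; [exact: b0|exact: m0].
  have c : (fun t => \sum_(k <- k :: s) f k t) = (fun t => 1 * f k t + \sum_(k <- s) f k t).
    by apply/funext => t; rewrite big_cons mul1r.
  rewrite {}c.
  split; last by rewrite m_lin// ?mf ?ms ?mulr0 ?addr0//; exists N.
  have [M' bM'] := bf k; exists (M' + N) => t.
  by rewrite mul1r (le_trans (ler_normD _ _))// lerD.
have bFe : Defs.bounded_fun (fun t => - e * 1 + \sum_(k <- enum 'I_n) f k t).
  have [N bN] := (bmF (enum 'I_n)).1; exists (`|e| + N) => t.
  by rewrite mulr1 (le_trans (ler_normD _ _))// lerD// normrN.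
have := m_pos _ bFe; rewrite m_lin//; last exact: (bmF _).1.
rewrite m1 (bmF _).2 addr0 mulr1 oppr_ge0; apply=> t.
by rewrite addrC subr_ge0; exact: He.
Qed.

(* Day's argument. If the bound fails for all densities [nu], the functional [P] below is
   sublinear, and an additive minorant of it gives bounded functions [phi (k, -)] with
   [sum_k (phi (k, x_k t) - phi (k, t)) >= e] for all [t], which no invariant mean allows. *)
Lemma reiter n (xs : 'I_n -> G) (e : R) : amenable R G -> 0 < e ->
  exists nu, density nu /\ l1 (displacement xs nu) < e * mass nu.
Proof.
move=> [m [m_lin m_pos m1 m_inv]] e0; apply: contrapT => no.
have far nu : density nu -> e * mass nu <= l1 (displacement xs nu).
  by move=> dnu; rewrite leNgt; apply/negP => lt; apply: no; exists nu.
pose D nu := displacement xs nu.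
have Ds nu : density nu -> summable_fun (D nu) by exact: displacement_summable.
pose B (h : 'I_n * G -> R) := [set r : R | exists nu, density nu /\
  r = l1 (fun z => h z + D nu z) - e * mass nu].
pose P h := inf (B h).
have density0 : density (fun=> 0 : R).
  by split=> [//|]; exists 0 => F uF; rewrite big1.
have B0 h : B h !=set0 by eexists; exists (fun=> 0); split; [exact: density0|].
(* This uses the assumed failure [far]: [l1 (h + D nu)] is at least [l1 (D nu) - l1 h], hence at
   least [e * mass nu - l1 h]. *)
have Blb h : summable_fun h -> has_lbound (B h).
  move=> hs; exists (- l1 h) => _ [nu [dnu ->]].
  have := l1D (summable_add hs (Ds _ dnu)) (summable_scale (-1) hs).
  rewrite (_ : (fun z => _) = D nu); last by apply/funext => z; ring.
  have := l1Z (-1) hs; rewrite normrN normr1 mul1r.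
  have := far _ dnu; rewrite -/(D nu); lra.
have Ple h nu : summable_fun h -> density nu ->
    P h <= l1 (fun z => h z + D nu z) - e * mass nu.
  by move=> hs dnu; apply: ge_inf; [exact: Blb|exists nu].
have P_add f g : summable_fun f -> summable_fun g -> P (fun z => f z + g z) <= P f + P g.
  move=> fs gs; apply/ler_addgt0Pr => d d0; have d20 : 0 < d / 2 by lra.
  have [|_ [nu1 [dnu1 ->]] lt1] := @inf_lt _ (B f) (P f + d / 2) (B0 f); first by rewrite ltrDl.
  have [|_ [nu2 [dnu2 ->]] lt2] := @inf_lt _ (B g) (P g + d / 2) (B0 g); first by rewrite ltrDl.
  have := Ple _ _ (summable_add fs gs) (densityD dnu1 dnu2).
  have [nu10 [M1 nu1M]] := dnu1; have [nu20 [M2 nu2M]] := dnu2.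
  rewrite (massD nu10 nu20 nu1M nu2M).
  have := l1D (summable_add fs (Ds _ dnu1)) (summable_add gs (Ds _ dnu2)).
  rewrite (_ : (fun z => _) = (fun z => f z + g z + D (fun y => nu1 y + nu2 y) z)).
    by move: lt1 lt2; lra.
  by apply/funext => z; rewrite /D /displacement; ring.
have P_scale c f : 0 < c -> summable_fun f -> P (fun z => c * f z) <= c * P f.
  move=> c0 fs; rewrite -ler_pdivrMl//; apply: lb_le_inf; first exact: B0.
  move=> _ [nu [dnu ->]]; rewrite ler_pdivrMl//.
  have := Ple _ _ (summable_scale c fs) (densityZ (ltW c0) dnu).
  have [nu0 [M nuM]] := dnu; rewrite (massZ nu0 nuM c0) => /le_trans; apply.
  have := l1Z c (summable_add fs (Ds _ dnu)); rewrite (gtr0_norm c0).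
  rewrite (_ : (fun z => c * _) = (fun z => c * f z + D (fun y => c * nu y) z)).
    by move=> H; rewrite mulrBr (mulrCA e) lerD2r.
  by apply/funext => z; rewrite /D /displacement; ring.
have [L [L_add LP]] := sublinear_minorant_fun (@summable_add _) (@summable_scale _) P_add P_scale.
have L_le h : summable_fun h -> L h <= l1 h.
  move=> hs; apply: (le_trans (LP _ hs)); apply: (le_trans (Ple _ _ hs density0)).
  rewrite mass0 mulr0 subr0 le_eqVlt; apply/orP; left; apply/eqP; congr (l1 _).
  by apply/funext => z; rewrite /D /displacement subrr addr0.
have s0 : summable_fun (fun _ : 'I_n * G => 0 : R).
  by exists 0 => F uF; rewrite big1// => ? _; rewrite normr0.
have L0 : L (fun=> 0) = 0.
  have := L_add _ _ s0 s0; rewrite (_ : (fun z => _) = (fun=> 0)); first by lra.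
  by apply/funext => z; rewrite addr0.
have LN h : summable_fun h -> L (fun z => -1 * h z) = - L h.
  move=> hs; have := L_add _ _ hs (summable_scale (-1) hs).
  rewrite (_ : (fun z => h z + _) = (fun=> 0)); first by rewrite L0; lra.
  by apply/funext => z; ring.
pose phi z := L (point_mass z).
have pms (z : 'I_n * G) : summable_fun (point_mass z) by exists 1; exact: point_mass_summable.
have phi1 z : `|phi z| <= 1.
  have pm1 := l1_le (point_mass_summable z).
  rewrite ler_norml lerNl /phi -(LN _ (pms z)).
  rewrite (le_trans (L_le _ (pms z)) pm1) andbT.
  apply: (le_trans (L_le _ (summable_scale (-1) (pms z)))).
  by apply: le_trans (l1Z (-1) (pms z)) _; rewrite normrN normr1 mul1r.
suff : e <= 0 by rewrite leNgt e0.
apply: (mean_displacement m_lin m_pos m1 m_inv phi1 (xs := xs)) => t.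
have Ls (s : seq 'I_n) :
    summable_fun (fun z => \sum_(k <- s) (-1 * point_mass (k, t) z + point_mass (k, gmul (xs k) t) z)) /\
    L (fun z => \sum_(k <- s) (-1 * point_mass (k, t) z + point_mass (k, gmul (xs k) t) z)) =
    \sum_(k <- s) (-1 * phi (k, t) + phi (k, gmul (xs k) t)).
  elim: s => [|k s [ss Ls]].
    rewrite big_nil (_ : (fun z => _) = (fun=> 0))//.
    by apply/funext => z; rewrite big_nil.
  rewrite big_cons (_ : (fun z => _) = (fun z =>
      (-1 * point_mass (k, t) z + point_mass (k, gmul (xs k) t) z) +
      \sum_(k <- s) (-1 * point_mass (k, t) z + point_mass (k, gmul (xs k) t) z))); last first.
    by apply/funext => z; rewrite big_cons.
  have sk := summable_add (summable_scale (-1) (pms (k, t))) (pms (k, gmul (xs k) t)).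
  split; first exact: summable_add.
  by rewrite L_add// Ls L_add ?LN ?mulN1r//; exact: summable_scale.
have <- := (Ls (enum 'I_n)).2.
have dt := point_mass_density t.
rewrite (_ : (fun z => _) = D (point_mass t)); last first.
  by apply/funext => z; rewrite /D displacement_point_mass.
(* At [- D (point_mass t)] the choice [nu = point_mass t] cancels the [l1] term, so [P] is at most
   [- e] there and [L (D (point_mass t))] is at least [e]. *)
have := LP _ (summable_scale (-1) (Ds _ dt)); rewrite LN; last exact: Ds.
move=> /le_trans/(_ (Ple _ _ (summable_scale (-1) (Ds _ dt)) dt)).
rewrite (_ : (fun z => _ + _) = (fun=> 0)); last by apply/funext => z; ring.
have -> : l1 (fun _ : 'I_n * G => 0 : R) = 0.
  by rewrite /l1 (_ : (fun=> _) = (fun=> 0)) ?mass0//; apply/funext => z; rewrite normr0.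
have mass1 : 1 <= mass (point_mass t).
  have := sums_le1 t (sums_le_mass (fun y => ler0n _ _) (point_mass_sums t)).
  by rewrite {1}/point_mass eqxx.
have : e <= e * mass (point_mass t) by rewrite ler_peMr// ltW.
lra.
Qed.

End Reiter.

(** * The bounded approximate identity of an amenable group *)

Section ApproximateIdentity.
Context {R : realType} {G : dgroup}.
Variable p : R.
Hypothesis hp : 1 < p.
Local Notation q := (conj_exp p).
Local Open Scope complex_scope.

Let p0 : 0 < p. Proof. exact: lt_trans hp. Qed.

Let q0 : 0 < q. Proof. by rewrite /conj_exp divr_gt0// subr_gt0. Qed.

Let pq : p^-1 + q^-1 = 1.
Proof. by rewrite /conj_exp invf_div; field; rewrite gt_eqF. Qed.

(** Factor each power as base times the power [p - 1], and enlarge the base of the latter to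
    [s + t]. *)
Lemma powR_superadd (s t : R) : 0 <= s -> 0 <= t -> s `^ p + t `^ p <= (s + t) `^ p.
Proof.
move=> s0 t0; rewrite -!(mulr_powRB1 _ p0) ?addr_ge0// mulrDl.
have p10 : 0 <= p - 1 by rewrite subr_ge0 ltW.
by apply: lerD; apply: ler_wpM2l => //; apply: ge0_ler_powR => //;
  rewrite ?nnegrE ?addr_ge0// ?lerDl ?lerDr.
Qed.

(** Superadditivity applied to the smaller root and the difference of the roots. It converts [l1]
    closeness of densities into [lp] closeness of their roots. *)
Lemma powR_root_dist (a b : R) : 0 <= a -> 0 <= b ->
  `|a `^ p^-1 - b `^ p^-1| `^ p <= `|a - b|.
Proof.
wlog ba : a b / b <= a => [H a0 b0|a0 b0].
  have [/H->//|/ltW/H] := leP b a.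
  by rewrite distrC (distrC a b); exact.
have root (c : R) : 0 <= c -> (c `^ p^-1) `^ p = c.
  by move=> c0; rewrite -powRrM mulVf ?gt_eqF// powRr1.
have le_root : b `^ p^-1 <= a `^ p^-1.
  by apply: ge0_ler_powR; rewrite ?nnegrE ?invr_ge0// ltW.
rewrite !ger0_norm ?subr_ge0//.
have d0 : 0 <= a `^ p^-1 - b `^ p^-1 by rewrite subr_ge0.
have := powR_superadd d0 (powR_ge0 b p^-1); rewrite subrK !root//; lra.
Qed.

Lemma normalized_displacement (E : seq G) (e : R) : amenable R G -> 0 < e ->
  exists mu : G -> R, [/\ forall y, 0 <= mu y, sums_le mu 1, mass mu = 1 &
    forall x, x \in E -> sums_le (fun y => `|mu (gmul (ginv x) y) - mu y|) e].
Proof.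
move=> am e0; pose xs := tnth (in_tuple E).
have [nu [dnu lt_nu]] := reiter xs am e0; have [nu0 [M nuM]] := dnu.
have nus := displacement_summable xs dnu.
(* The strict inequality in [reiter] excludes zero mass. *)
have M0 : 0 < mass nu.
  rewrite -(pmulr_rgt0 _ e0); apply: le_lt_trans lt_nu.
  exact: sums_le_ge0 (l1_sums_le nus).
have Mi0 : 0 < (mass nu)^-1 by rewrite invr_gt0.
have mu0 y : 0 <= (mass nu)^-1 * nu y by rewrite mulr_ge0// ltW.
have mass1 : mass (fun y => (mass nu)^-1 * nu y) = 1.
  by rewrite (massZ nu0 nuM Mi0) mulVf// gt_eqF.
exists (fun y => (mass nu)^-1 * nu y); split=> [//||//|_ /(tnthP (in_tuple E))[k ->]].
  by rewrite -mass1; apply: sums_le_mass (sums_leZ (ltW Mi0) nuM).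
have inj : injective (fun y : G => (k, y)) by move=> y y' [].
have := sums_leZ (ltW Mi0) (sums_le_inj inj (l1_sums_le nus)).
apply: sums_leW => [y|]; last by rewrite mulrC ler_pdivrMr// ltW.
by rewrite -mulrBr normrM gtr0_norm.
Qed.

(* For a probability density [mu], the function [mu^(1/q) * (mu^(1/p))^v] lies in the unit
   ball and takes the value [mass mu] at the identity; almost invariance of [mu] spreads
   this value to all points of [E]. *)
Lemma amenable_approximate_identity (E : seq G) (e : R) : amenable R G -> 0 < e ->
  exists v, Ap_ball p v /\ forall x, x \in E -> cabs (v x - 1) < e.
Proof.
move=> am e0; have e20 : 0 < e / 2 by lra.
(* The tolerance is a [p]-th power because [powR_root_dist] bounds the [p]-th power of the [lp]
   distance. *)
have [mu [mu0 mu1 massmu muE]] := normalized_displacement E am (powR_gt0 p e20).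
pose f y : R[i] := (mu y `^ p^-1)%:C; pose g y : R[i] := (mu y `^ q^-1)%:C.
have root (s : R) y : 0 < s -> cabs (mu y `^ s^-1)%:C `^ s = mu y.
  move=> s0; rewrite cabs_real ger0_norm ?powR_ge0//.
  by rewrite -powRrM mulVf ?gt_eqF// powRr1.
have f1 : lp_le p f 1.
  by split=> //; rewrite powR1; apply: sums_leW (lexx _) mu1 => y; rewrite root.
have g1 : lp_le q g 1.
  by split=> //; rewrite powR1; apply: sums_leW (lexx _) mu1 => y; rewrite root.
have [vA vn] := Ap_conv hp f1 g1; exists (Defs.conv g (check f)); split.
  by split=> //; rewrite mulr1 in vn.
move=> x xE.
have gf1 : hassumC (fun y => g y * f y) 1.
  have := hassumC_mass mu0 mu1; rewrite massmu; apply: hassumC_eq => y.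
  rewrite /f /g -rmorphM; congr (_%:C).
  rewrite -powRD; first by rewrite addrC pq powRr1.
  by rewrite addrC pq oner_eq0.
have diff : lp_le p (fun y => f (gmul (ginv x) y) - f y) (e / 2).
  split; first exact: ltW.
  apply: sums_leW (lexx _) (muE x xE) => y.
  by rewrite /f -rmorphB cabs_real powR_root_dist.
(* Since [g f = mu] has sum [1], the difference [v x - 1] is the sum of [g y * (f (x^-1 y) - f y)],
   to which Hölder applies. *)
have hdiff := hassumC_lin (-1) gf1 (hassum_conv hp x f1 g1).
apply: (@le_lt_trans _ _ (e / 2)); last by lra.
rewrite -[leRHS]mulr1; apply: hassumC_le (lp_holder hp diff g1) _.
rewrite addrC -mulN1r; apply: hassumC_eq hdiff => y; ring.
Qed.

End ApproximateIdentity.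

Unset Implicit Arguments.

Theorem theorem4p2 (R : realType) (G : dgroup) (p : R) (hp : 1 < p) :
  (forall u : G -> R[i], Ap p u -> WCBp p u) /\
  (amenable R G -> forall u : G -> R[i], WCBp p u <-> Ap p u).
Proof.
have sub u : Ap p u -> WCBp p u.
  by move=> uA; split; [exact: Ap_Bp|exact: Ap_Gamma_weakly_compact].
split; first exact: sub.
move=> am u; split; last exact: sub.
exact: (WCBp_Ap hp (fun E e e0 => amenable_approximate_identity hp E am e0)).
Qed.
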